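(* Let $(G,T)$ be a bipartite graft, let $r\in V(G)$, and let $K$ be a decapital distance component of $(G,T)$ with respect to $r$. Let $\tilde S_K$ be the root fragment of $K$, and for each $S\in\mathcal{A}(K)\setminus\{\tilde S_K\}$ let $C_S$ be the factor-component of $(G,T)$ containing $S$. Then: (i) $\mathcal{A}(K)$ is a partition of $A(K)$; (ii) $V(C_S)\subseteq V(K)$ for every $S\in\mathcal{A}(K)\setminus\{\tilde S_K\}$; (iii) the set of connected components of $G[D(K)]$ is the disjoint union of the families $\mathcal{N}_K(S)$ over $S\in\mathcal{A}(K)$.
   Context: All graphs are finite. For a graph $G$ and $X\subseteq V(G)$, $\partial_G(X)$ is the set of edges with exactly one end in $X$; for a subgraph $H$, $\partial_G(H):=\partial_G(V(H))$. A graft is a pair $(G,T)$ with $T\subseteq V(G)$ such that every connected component of $G$ contains an even number of vertices of $T$; bipartite if $G$ is. A join is a set $F\subseteq E(G)$ such that every vertex in $T$ is incident with an odd number of edges of $F$ and every other vertex with an even number; $\nu(G,T)$ is the minimum size of a join; minimum joins are joins of that size. For $F\subseteq E(G)$, $w_F(e)=-1$ if $e\in F$, $+1$ otherwise, extended additively to paths; for a minimum join $F$, $d_F(x,y)$ is the minimum $F$-weight of a path between $x$ and $y$ (independent of $F$). For a root $r$ and integer $i$, $L_{\le i}(r)=\{x:d_F(r,x)\le i\}$; the distance components with respect to $r$ are the connected components of $G[L_{\le i}(r)]$ for $i\in\{d_F(r,x):x\in V(G)\}$; those not containing $r$ are decapital. For a distance component $K$, let $A(K)$ be the set of vertices $x\in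 V(K)$ with $d_F(r,x)=\max_{y\in V(K)}d_F(r,y)$, and $D(K):=V(K)\setminus A(K)$. An edge is allowed if it lies in some minimum join. Two vertices are factor-connected if joined by a path of allowed edges; a factor-component is a maximal subgraph in which every two vertices are factor-connected. Write $u\sim v$ if $u=v$, or $u,v$ are distinct vertices of the same factor-component with $\nu(G,T)=\nu(G,T\Delta\{u,v\})$; $\sim$ is an equivalence relation whose classes (forming the family $\mathcal{P}(G,T)$) each lie in a factor-component. For a decapital distance component $K$, the ends inside $V(K)$ of the allowed edges of $\partial_G(K)$ all lie in one class $S_K\in\mathcal{P}(G,T)$, called the root class of $K$, and the ends outside $V(K)$ all lie in one class $T_K$, the antiroot class (these sets are nonempty); the root fragment of $K$ is $\tilde S_K:=S_K\cap V(K)$. Define $\mathcal{A}(K):=\{\tilde S_K\}\cup\{S\in\mathcal{P}(G,T)\setminus\{S_K\}: S\cap A(K)\neq\emptyset\}$. For $S\subseteq V(G)$ with $S\cap A(K)\ne\emptyset$, $\mathcal{N}_K(S)$ is the family of connected components of $G[D(K)]$ that contain a vertex joined by an allowed edge to a vertex of $S$. *)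

(* Defs.v *)
From HB Require Import structures.
From mathcomp Require Import all_boot all_order all_algebra.
From mathcomp Require Import constructive_ereal.

Set Implicit Arguments.
Unset Strict Implicit.
Unset Printing Implicit Defensive.

Import Order.TTheory GRing.Theory Num.Theory.

(* Finite graphs, possibly with parallel edges. Loops are left out: a bipartite
   graph has none. *)
Record graph := Graph {
  vertex : finType;
  edge : finType;
  ends : edge -> {set vertex};
  card_ends : forall e, #|ends e| = 2
}.

Definition bipartite (G : graph) : Prop :=
  exists A : {set vertex G}, forall e : edge G, #|ends e :&: A| = 1.

Definition boundary (G : graph) (X : {set vertex G}) : {set edge G} :=
  [set e | #|ends e :&: X| == 1].

Definition induced_adj (G : graph) (X : {set vertex G}) : rel (vertex G) :=
  [rel x y | [&& x \in X, y \in X & [exists e, ends e == [set x; y]]]].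

(* Connected components, here and below, are represented by their vertex sets;
   [components X] lists those of the subgraph induced by [X]. *)
Definition components (G : graph) (X : {set vertex G}) : {set {set vertex G}} :=
  equivalence_partition (connect (induced_adj X)) X.

Definition graft (G : graph) (T : {set vertex G}) : Prop :=
  forall C, C \in components [set: vertex G] -> ~~ odd #|C :&: T|.

Definition is_join (G : graph) (T : {set vertex G}) (F : {set edge G}) : bool :=
  [forall v, odd #|[set e in F | v \in ends e]| == (v \in T)].

(* The default value [#|edge G|] bounds the size of every join, so it does not
   affect the minimum as soon as there is a join. *)
Definition nu (G : graph) (T : {set vertex G}) : nat :=
  \big[minn/#|edge G|]_(F : {set edge G} | is_join T F) #|F|.

Definition minimum_join (G : graph) (T : {set vertex G}) (F : {set edge G}) :
  bool := is_join T F && (#|F| == nu T).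

(* The walk [x0, e1, x1, ..., en, xn] is encoded by its first vertex [x0] and
   the sequence [:: (e1, x1); ...; (en, xn)]. *)
Fixpoint is_walk (G : graph) (x : vertex G) (p : seq (edge G * vertex G)) :
    bool :=
  if p is (e, y) :: q then (ends e == [set x; y]) && is_walk y q else true.

Definition is_path (G : graph) (x y : vertex G)
    (p : seq (edge G * vertex G)) : bool :=
  [&& is_walk x p, uniq (x :: unzip2 p) & last x (unzip2 p) == y].

Definition weight (G : graph) (F : {set edge G})
    (p : seq (edge G * vertex G)) : int :=
  (\sum_(s <- p) (if s.1 \in F then -1 else 1))%R.

(* The minimum over all paths between [x] and [y], +oo if there is none. A path
   has fewer than [#|vertex G|] edges, so the bound on the length loses none;
   see [dist_le] and [dist_attained]. *)
Definition dist (G : graph) (F : {set edge G}) (x y : vertex G) : \bar int :=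
  \big[Order.min/+oo%E]_(n < #|vertex G|)
    \big[Order.min/+oo%E]_(p : n.-tuple (edge G * vertex G) | is_path x y p)
      (weight F p)%:E%E.

Lemma dist_le (G : graph) (F : {set edge G}) (x y : vertex G) p :
  is_path x y p -> (dist F x y <= (weight F p)%:E)%O.
Proof.
move=> pP; have lt_p : size p < #|vertex G|.
  case/and3P: pP => _ /card_uniqP pU _.
  by rewrite -(size_map snd) -[_.+1]/(size (x :: unzip2 p)) -pU max_card.
apply: (le_trans (bigmin_le _ (Ordinal lt_p) _)) => /=.
exact: (bigmin_le_cond _ (j := in_tuple p)).
Qed.

Lemma dist_attained (G : graph) (F : {set edge G}) (x y : vertex G) p :
  is_path x y p -> exists2 q, is_path x y q & dist F x y = (weight F q)%:E%E.
Proof.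
move=> pP; have := dist_le F pP.
pose P (z : \bar int) :=
  z = +oo%E \/ exists2 q, is_path x y q & z = (weight F q)%:E%E.
suff: P (dist F x y) by case=> // ->.
have Pmin a b : P a -> P b -> P (Order.min a b).
  by move=> Pa Pb; case: (leP a b).
apply: (big_ind P) => //; first by left.
move=> n _; apply: (big_ind P) => //; first by left.
by move=> q qP; right; exists q.
Qed.

Definition level_le (G : graph) (F : {set edge G}) (r : vertex G) (i : int) :
  {set vertex G} := [set x | (dist F r x <= i%:E)%O].

Definition distance_component (G : graph) (F : {set edge G}) (r : vertex G)
    (K : {set vertex G}) : Prop :=
  exists2 i : int, exists x, dist F r x = i%:E%E
                 & K \in components (level_le F r i).

Definition decapital (G : graph) (F : {set edge G}) (r : vertex G)
    (K : {set vertex G}) : Prop :=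
  distance_component F r K /\ r \notin K.

Definition Aset (G : graph) (F : {set edge G}) (r : vertex G)
    (K : {set vertex G}) : {set vertex G} :=
  [set x in K | [forall y in K, (dist F r y <= dist F r x)%O]].

Definition Dset (G : graph) (F : {set edge G}) (r : vertex G)
    (K : {set vertex G}) : {set vertex G} := K :\: Aset F r K.

Definition allowed (G : graph) (T : {set vertex G}) (e : edge G) : bool :=
  [exists F : {set edge G}, minimum_join T F && (e \in F)].

Definition allowed_adj (G : graph) (T : {set vertex G}) : rel (vertex G) :=
  [rel x y | [exists e, allowed T e && (ends e == [set x; y])]].

Definition factor_connected (G : graph) (T : {set vertex G}) :
  rel (vertex G) := connect (allowed_adj T).

Definition factor_component (G : graph) (T C : {set vertex G}) : bool :=
  maxset [pred X : {set vertex G} |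
    [forall x in X, forall y in X, factor_connected T x y]] C.

Definition symdiff (V : finType) (A B : {set V}) : {set V} :=
  (A :\: B) :|: (B :\: A).

Definition sim (G : graph) (T : {set vertex G}) : rel (vertex G) :=
  [rel u v | (u == v) || (
    [exists C, [&& factor_component T C, u \in C & v \in C]] &&
    (nu T == nu (symdiff T [set u; v])))].

Definition sim_classes (G : graph) (T : {set vertex G}) :
    {set {set vertex G}} :=
  equivalence_partition (sim T) [set: vertex G].

Definition inner_ends (G : graph) (T K : {set vertex G}) : {set vertex G} :=
  [set x in K | [exists e in boundary K, allowed T e && (x \in ends e)]].

(* When [inner_ends T K] is nonempty and lies in a single class, this is that
   class. *)
Definition root_class (G : graph) (T K : {set vertex G}) : {set vertex G} :=
  odflt set0 [pick S in sim_classes T | inner_ends T K \subset S].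

Definition root_fragment (G : graph) (T K : {set vertex G}) :
  {set vertex G} := root_class T K :&: K.

Definition Afamily (G : graph) (T : {set vertex G}) (F : {set edge G})
    (r : vertex G) (K : {set vertex G}) : {set {set vertex G}} :=
  root_fragment T K |:
    [set S in sim_classes T :\ root_class T K | S :&: Aset F r K != set0].

Definition Nfamily (G : graph) (T : {set vertex G}) (F : {set edge G})
    (r : vertex G) (K S : {set vertex G}) : {set {set vertex G}} :=
  [set C in components (Dset F r K) |
    [exists x in C, exists y in S, allowed_adj T x y]].

(* Main.v *)
(* Write d(r,x) for the distance from the root and fix U = T Δ {r}; then a
   minimum join of U Δ {x} has nu(T) + d(r,x) edges, so distance components are
   components of sublevel sets of x |-> nu(U Δ {x}). In a bipartite graph this
   function changes by exactly 1 along every edge, so each edge lies on the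
   boundary of exactly one level component.

   Sebő's theorem: a minimum join of U Δ {v} has no edge on the boundary of a
   level component K if v is in K, and exactly one otherwise. It goes by
   induction on the level of K: by induction, sets inside K whose odd vertices
   are on its top level have nonnegative weight, because they meet every lower
   cut in an even number of edges while the join meets it at most once. This
   permits moving the root of a join along the edges of K without changing its
   trace on the boundary; but a join rooted at an end of a boundary edge cannot
   use that edge. If v is outside K, switching along a path of the difference of
   two joins that crosses the boundary only once must remove all boundary edges.

   The same cut counting shows nu(T Δ {x,y}) >= nu(T) for x, y in A(K), and
   factor-connectedness gives the reverse inequality, so on A(K) the relation ~
   is factor-connectedness. An allowed path from A(K) leaves K only through the
   root class, and enters a component of G[D(K)] through a unique class; an
   outer end of an allowed boundary edge of such a component is at negative
   distance from all its vertices, so no class meeting A(K) meets D(K). Hence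
   the family of the theorem is the quotient of A(K) by ~. *)

Require Import Defs.
From HB Require Import structures.
From mathcomp Require Import all_boot all_order all_algebra.
From mathcomp Require Import constructive_ereal.
From mathcomp Require Import zify.

Import Order.TTheory.

Set Implicit Arguments.
Unset Strict Implicit.
Unset Printing Implicit Defensive.

Local Notation "A :+: B" := (symdiff A B) (at level 52, left associativity).

(** * Symmetric differences of finite sets *)

Section SymDiff.
Variable V : finType.
Implicit Types (A B C F D : {set V}) (x : V).

Lemma in_symdiff A B x : (x \in A :+: B) = (x \in A) (+) (x \in B).
Proof. by rewrite !inE; case: (x \in A); case: (x \in B). Qed.

Lemma symdiffC A B : A :+: B = B :+: A.
Proof. by apply/setP=> x; rewrite !in_symdiff addbC. Qed.

Lemma symdiffA A B C : A :+: (B :+: C) = A :+: B :+: C.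
Proof. by apply/setP=> x; rewrite !in_symdiff addbA. Qed.

Lemma symdiff0 A : A :+: set0 = A.
Proof. by apply/setP=> x; rewrite in_symdiff inE addbF. Qed.

Lemma symdiffxx A : A :+: A = set0.
Proof. by apply/setP=> x; rewrite in_symdiff addbb inE. Qed.

Lemma symdiffK A B : A :+: B :+: B = A.
Proof. by apply/setP=> x; rewrite !in_symdiff addbK. Qed.

Lemma symdiff_set2 x y : x != y -> [set x; y] = [set x] :+: [set y].
Proof.
move=> /negPf xy; apply/setP=> z; rewrite in_symdiff !inE.
by case: (eqVneq z x) => // ->; rewrite xy.
Qed.

Lemma card_symdiff F D : #|F :+: D| + 2 * #|F :&: D| = #|F| + #|D|.
Proof.
rewrite /symdiff cardsU.
have -> : (F :\: D) :&: (D :\: F) = set0.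
  by apply/setP=> x; rewrite !inE; case: (x \in F); case: (x \in D).
have := cardsID D F; have := cardsID F D; rewrite setIC cards0; lia.
Qed.

(* Switching [F] and [F'] along a subset of their difference keeps the total size,
   because the switched elements merely change sides. *)
Lemma card_symdiff_balance F F' D : D \subset F :+: F' ->
  #|F :+: D| + #|F' :+: D| = #|F| + #|F'|.
Proof.
move=> /subsetP sD; have := card_symdiff F D; have := card_symdiff F' D.
suff : #|F :&: D| + #|F' :&: D| = #|D| by lia.
rewrite -(cardsID F D) setIC; congr (_ + _); apply: eq_card => x.
rewrite !inE; case xD: (x \in D); rewrite ?andbF ?andbT //.
by move: (sD x xD); rewrite in_symdiff; case: (x \in F); case: (x \in F').
Qed.

Lemma card_symdiff1 F x : x \in F -> #|F :+: [set x]| = #|F|.-1.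
Proof.
move=> xF; have := card_symdiff F [set x].
by rewrite (setIidPr _) ?sub1set // cards1; lia.
Qed.

Lemma card_symdiff1N F x : x \notin F -> #|F :+: [set x]| = #|F|.+1.
Proof.
move=> xF; have := card_symdiff F [set x].
suff -> : F :&: [set x] = set0 by rewrite cards0 cards1; lia.
by apply/setP=> y; rewrite !inE; case: eqP => [->|]; rewrite ?(negPf xF) ?andbF.
Qed.

Lemma odd_card_symdiff A B : odd #|A :+: B| = odd #|A| (+) odd #|B|.
Proof. by rewrite -oddD -card_symdiff; lia. Qed.

Lemma symdiffIl A B C : (A :+: B) :&: C = (A :&: C) :+: (B :&: C).
Proof.
by apply/setP=> x; rewrite !(in_symdiff, in_setI); case: (x \in C); rewrite ?andbT ?andbF.
Qed.

Lemma symdiff_setI A B : A :+: (A :&: B) = A :\: B.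
Proof.
apply/setP=> x; rewrite in_symdiff in_setD in_setI.
by case: (x \in A); case: (x \in B).
Qed.

End SymDiff.

(** * Edge sets, their odd vertices and their cuts *)

Section EdgeSets.
Variable G : graph.
Implicit Types (X T : {set vertex G}) (J F Q : {set edge G}) (e : edge G).

Lemma endsP e : exists x y, x != y /\ ends e = [set x; y].
Proof. by have /eqP/cards2P [x [y [xy ->]]] := card_ends e; exists x, y. Qed.

Lemma ends_at e x : x \in ends e -> exists2 y, x != y & ends e = [set x; y].
Proof.
have [a [b [ab ->]]] := endsP e; rewrite !inE => /orP[/eqP->|/eqP->].
  by exists b.
by exists a; rewrite 1?eq_sym // setUC.
Qed.

Lemma ends_neq e x y : ends e = [set x; y] -> x != y.
Proof. by move=> E; have := card_ends e; rewrite E cards2; case: eqP. Qed.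

(** The boundary operator of the graph over the two-element field. Its additivity lets joins be
    shifted by adding edge sets. *)
Definition odd_vertices J : {set vertex G} :=
  [set v | odd #|[set e in J | v \in ends e]|].

Lemma is_joinE T J : is_join T J = (odd_vertices J == T).
Proof.
apply/forallP/eqP => [H|<- v]; last by rewrite inE.
by apply/setP=> v; rewrite inE; apply/eqP.
Qed.

Lemma odd_vertices_symdiff J J' :
  odd_vertices (J :+: J') = odd_vertices J :+: odd_vertices J'.
Proof.
apply/setP=> v; rewrite in_symdiff !inE -odd_card_symdiff; congr (odd _).
by apply: eq_card => e; rewrite !(in_symdiff, inE); case: (v \in _); rewrite ?andbT ?andbF.
Qed.

Lemma odd_vertices1 e : odd_vertices [set e] = ends e.
Proof.
apply/setP=> v; rewrite inE.
have -> : [set e' in [set e] | v \in ends e'] = if v \in ends e then [set e] else set0.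
  by apply/setP=> e'; case: ifP => ve; rewrite !inE; case: eqP => // ->; rewrite ve.
by case: ifP; rewrite ?cards1 ?cards0.
Qed.

Lemma odd_vertices_edge J v : v \in odd_vertices J -> exists2 e, e \in J & v \in ends e.
Proof.
rewrite inE; case: (set_0Vmem [set e in J | v \in ends e]) => [->|[e]]; first by rewrite cards0.
by rewrite inE => /andP[eJ ve] _; exists e.
Qed.

Lemma odd_verticesE J J' v :
  (forall e, v \in ends e -> (e \in J) = (e \in J')) ->
  (v \in odd_vertices J) = (v \in odd_vertices J').
Proof.
move=> H; rewrite !inE; congr (odd _); apply: eq_card => e; rewrite !inE.
by case ve: (v \in ends e); rewrite ?andbF ?andbT // H.
Qed.

Lemma card_ends_in X e x y : ends e = [set x; y] ->
  #|ends e :&: X| = (x \in X) + (y \in X).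
Proof.
move=> E; rewrite E; have xy := ends_neq E; rewrite setIUl cardsU.
have -> : [set x] :&: X :&: ([set y] :&: X) = set0.
  by apply/setP=> z; rewrite !inE; case: (eqVneq z x) => [->|]; rewrite ?(negPf xy) ?andbF.
have card1 z : #|[set z] :&: X| = (z \in X).
  case zX: (z \in X); first by rewrite (setIidPl _) ?cards1 ?sub1set.
  by apply/eqP; rewrite cards_eq0; apply/eqP/setP=> t; rewrite !inE; case: eqP => // ->.
by rewrite cards0 subn0 !card1.
Qed.

Lemma boundaryP X e : reflect
  (exists x y, [/\ ends e = [set x; y], x \in X & y \notin X]) (e \in boundary X).
Proof.
apply: (iffP idP); rewrite inE.
  have [x [y [xy E]]] := endsP e; rewrite (card_ends_in _ E).
  case xX: (x \in X); case yX: (y \in X) => // _.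
    by exists x, y; rewrite xX yX.
  by exists y, x; rewrite xX yX setUC.
by move=> [a [b [E aX bX]]]; rewrite (card_ends_in _ E) aX (negPf bX).
Qed.

Lemma edge_set_ind (P : {set edge G} -> Prop) :
  P set0 -> (forall e J, e \notin J -> P J -> P (J :+: [set e])) -> forall J, P J.
Proof.
move=> P0 PS J; elim: {J}_.+1 {-2}J (ltnSn #|J|) => // n IHn J lt_n.
case: (set_0Vmem J) => [->//|[e eJ]].
rewrite -(symdiffK J [set e]); apply: PS; first by rewrite in_symdiff eJ inE eqxx.
apply: IHn; rewrite card_symdiff1 //.
by have : 0 < #|J| by [apply/card_gt0P; exists e]; lia.
Qed.

(** Both parities are additive under symmetric difference, so a single edge suffices: it has an odd
    number of ends in [X] exactly when it is on the boundary. *)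
Lemma card_boundary_parity X J :
  odd #|J :&: boundary X| = odd #|odd_vertices J :&: X|.
Proof.
elim/edge_set_ind: J => [|e J _ IHJ].
  suff -> : odd_vertices set0 = set0 by rewrite !set0I !cards0.
  apply/setP=> v; rewrite inE [RHS]inE.
  suff -> : [set e in set0 | v \in ends e] = set0 by rewrite cards0.
  by apply/setP=> e; rewrite !inE.
rewrite odd_vertices_symdiff !symdiffIl !odd_card_symdiff IHJ odd_vertices1.
congr (_ (+) _); case eX: (e \in boundary X).
  by rewrite (setIidPl _) ?sub1set // cards1; move: eX; rewrite inE => /eqP->.
have -> : [set e] :&: boundary X = set0.
  by apply/setP=> f; rewrite in_setI in_set1 in_set0; case: eqP => // ->.
have : #|ends e :&: X| <= 2 by rewrite -(card_ends e) subset_leq_card ?subsetIl.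
by move: eX; rewrite inE cards0; case: #|_| => [|[|[|]]].
Qed.

(** Trail argument: delete an edge at [x]. Its other end is either odd in [J], or becomes odd in the
    remaining set, where the induction continues. The extracted set replaces a path but need not be
    one. *)
Lemma odd_vertices_pair J x : x \in odd_vertices J ->
  exists y Q, [/\ y \in odd_vertices J, y != x, Q \subset J & odd_vertices Q = [set x; y]].
Proof.
elim: {J}_.+1 {-2}J (ltnSn #|J|) x => // n IHn J lt_n x xJ.
have [e eJ xe] := odd_vertices_edge xJ.
have [z xz E] := ends_at xe.
case zJ: (z \in odd_vertices J).
  by exists z, [set e]; rewrite zJ sub1set eJ odd_vertices1 E eq_sym xz.
have lt1 : #|J :+: [set e]| < n.
  by rewrite card_symdiff1 //; have : 0 < #|J| by [apply/card_gt0P; exists e]; lia.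
have bE : odd_vertices (J :+: [set e]) = odd_vertices J :+: [set x; z].
  by rewrite odd_vertices_symdiff odd_vertices1 E.
have [|y [Q [yJ yz QJ bQ]]] := IHn _ lt1 z.
  by rewrite bE in_symdiff zJ !inE eqxx orbT.
have eQ : e \notin Q.
  by apply/negP=> /(subsetP QJ); rewrite in_symdiff eJ inE eqxx.
have yx : y != x by apply/eqP=> yx; move: yJ; rewrite bE in_symdiff yx xJ !inE eqxx.
exists y, (Q :+: [set e]); split=> //.
- by move: yJ; rewrite bE in_symdiff !inE (negPf yz) (negPf yx) addbF.
- apply/subsetP=> f; rewrite in_symdiff inE; case: eqP => [->//|_]; rewrite addbF.
  by move/(subsetP QJ); rewrite in_symdiff inE; case: eqP => [->//|_]; rewrite addbF.
- rewrite odd_vertices_symdiff odd_vertices1 E bQ symdiffC symdiff_set2 //.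
  by rewrite symdiff_set2 1?eq_sym // symdiffA symdiffK symdiff_set2 1?eq_sym.
Qed.

Definition has_join T := [exists F, is_join T F].

Lemma nu_le T J : is_join T J -> nu T <= #|J|.
Proof.
by move=> TJ; rewrite /nu -minEnat -leEnat; exact: (bigmin_le_cond _ (j := J)).
Qed.

(** The bound by [#|edge G|] takes care of the default value with which the minimum starts. *)
Lemma nu_ge T n : n <= #|edge G| -> (forall J, is_join T J -> n <= #|J|) -> n <= nu T.
Proof.
move=> nE H; rewrite /nu; apply: (big_ind (fun m => n <= m)) => // a b.
by rewrite leq_min => -> ->.
Qed.

Lemma minimum_join_le T F J : minimum_join T F -> is_join T J -> #|F| <= #|J|.
Proof. by case/andP=> _ /eqP-> /nu_le. Qed.

Lemma nu_attained T : has_join T -> exists F, minimum_join T F.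
Proof.
move=> /existsP[J TJ].
have [F TF Fmin] := @arg_minnP _ J (is_join T) (fun F => #|F|) TJ.
exists F; rewrite /minimum_join TF eqn_leq nu_le // andbT.
by apply: nu_ge => //; exact: max_card.
Qed.

Lemma minimum_join_nu T F : minimum_join T F -> #|F| = nu T.
Proof. by case/andP=> _ /eqP. Qed.

Lemma minimum_joinP T F : minimum_join T F -> odd_vertices F = T.
Proof. by case/andP; rewrite is_joinE => /eqP. Qed.

Lemma minimum_join_intro T F : odd_vertices F = T -> #|F| <= nu T -> minimum_join T F.
Proof.
move=> TF le; have J : is_join T F by rewrite is_joinE TF.
by rewrite /minimum_join J eqn_leq le nu_le.
Qed.

Lemma nu_le_odd J : nu (odd_vertices J) <= #|J|.
Proof. by apply: nu_le; rewrite is_joinE. Qed.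

Definition inner_edges X : {set edge G} := [set e | ends e \subset X].

Lemma inner_or_boundary X e x : x \in ends e -> x \in X ->
  (e \in inner_edges X) (+) (e \in boundary X).
Proof.
move=> xe xX; have [y xy E] := ends_at xe.
have -> : (e \in inner_edges X) = (y \in X) by rewrite inE E subUset !sub1set xX.
case yX: (y \in X) => /=.
  apply/boundaryP=> -[a [b [E2 aX /negP]]]; apply.
  have : b \in ends e by rewrite E2 !inE eqxx orbT.
  by rewrite E !inE => /orP[]/eqP->.
by apply/boundaryP; exists x, y; rewrite yX.
Qed.

Lemma inner_not_boundary X e : e \in inner_edges X -> e \notin boundary X.
Proof.
rewrite inE => /subsetP sX; apply/boundaryP=> -[a [b [E _ /negP]]]; apply.
by apply: sX; rewrite E !inE eqxx orbT.
Qed.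

Lemma odd_vertices_inner X J : J :&: boundary X = set0 ->
  odd_vertices (J :&: inner_edges X) = odd_vertices J :&: X.
Proof.
move=> /setP J0; apply/setP=> v; rewrite in_setI; case vX: (v \in X).
  rewrite andbT; apply: odd_verticesE => e ve; rewrite in_setI.
  have := inner_or_boundary ve vX; have := J0 e; rewrite !in_setI in_set0.
  by case: (e \in J) => //= ->; rewrite addbF.
rewrite andbF; apply/negP=> /odd_vertices_edge[e]; rewrite in_setI => /andP[_].
by rewrite inE => /subsetP sX /sX; rewrite vX.
Qed.

End EdgeSets.

(** * Levels *)

Section Levels.
Variables (G : graph) (U : {set vertex G}).
Implicit Types (u v x y z : vertex G) (D J F Q : {set edge G}) (e : edge G).

(** For [U] = [T] Δ {r} with [T] having a join, these are the vertices in the connected component of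
    [r], that is, those at finite distance. *)
Definition reach v := has_join (U :+: [set v]).
(* Junk unless [reach v]: [nu] is then the number of edges. *)
Definition root_level v := nu (U :+: [set v]).
Local Notation level := root_level.
Definition sublevel n : {set vertex G} := [set v | reach v && (level v <= n)].
Definition level_comp u : {set vertex G} :=
  [set z | connect (induced_adj (sublevel (level u))) u z].

Lemma reach_level v : reach v ->
  exists F, [/\ minimum_join (U :+: [set v]) F, odd_vertices F = U :+: [set v]
               & #|F| = level v].
Proof.
move=> /nu_attained[F Fm]; exists F; split=> //; first exact: minimum_joinP.
exact: minimum_join_nu.
Qed.

Lemma reach_intro v J : odd_vertices J = U :+: [set v] -> reach v.
Proof. by move=> E; apply/existsP; exists J; rewrite is_joinE E. Qed.

Lemma level_le_card v J : odd_vertices J = U :+: [set v] -> level v <= #|J|.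
Proof. by rewrite /root_level => <-; exact: nu_le_odd. Qed.

Lemma join_shift x y Q J : odd_vertices J = U :+: [set x] ->
  odd_vertices Q = [set x] :+: [set y] -> odd_vertices (J :+: Q) = U :+: [set y].
Proof. by move=> JE QE; rewrite odd_vertices_symdiff JE QE symdiffA symdiffK. Qed.

Lemma join_shift_edge x y e J : odd_vertices J = U :+: [set x] ->
  ends e = [set x; y] -> odd_vertices (J :+: [set e]) = U :+: [set y].
Proof.
move=> JE E; apply: join_shift JE _; rewrite odd_vertices1 E symdiff_set2 //.
exact: ends_neq E.
Qed.

Lemma reach_edge e x y : ends e = [set x; y] -> reach x -> reach y.
Proof. by move=> E /reach_level[F [_ FE _]]; apply: reach_intro (join_shift_edge FE E). Qed.

Lemma level_edge_le e x y : ends e = [set x; y] -> reach x -> level y <= (level x).+1.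
Proof.
move=> E /reach_level[F [_ FE <-]].
apply: leq_trans (level_le_card (join_shift_edge FE E)) _.
by have := card_symdiff F [set e]; rewrite cards1; lia.
Qed.

Lemma mem_level_comp u : u \in level_comp u.
Proof. by rewrite inE. Qed.

Lemma induced_adj_sym (X : {set vertex G}) : symmetric (induced_adj X).
Proof.
move=> x y; rewrite /induced_adj /= andbCA; congr [&& _, _ & _].
by apply: eq_existsb => e; rewrite setUC.
Qed.

Lemma connect_induced_adj_mem (X : {set vertex G}) x y :
  connect (induced_adj X) x y -> x \in X -> y \in X.
Proof.
by move=> xy; rewrite (closed_connect _ xy) // => a b /and3P[-> -> _].
Qed.

Lemma induced_adj_intro (X : {set vertex G}) e x y :
  ends e = [set x; y] -> x \in X -> y \in X -> induced_adj X x y.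
Proof. by move=> E xX yX; apply/and3P; split=> //; apply/existsP; exists e; rewrite E. Qed.

Lemma level_compP u z : reach u -> z \in level_comp u -> reach z /\ level z <= level u.
Proof.
move=> ru; rewrite inE => /connect_induced_adj_mem.
by rewrite !inE ru leqnn => /(_ isT) /andP[].
Qed.

Lemma level_comp_sub u z : reach u -> z \in level_comp u -> level_comp z \subset level_comp u.
Proof.
move=> ru zu; have [rz le_zu] := level_compP ru zu.
apply/subsetP=> t; rewrite !inE; rewrite inE in zu => zt; apply: connect_trans zu _.
apply: connect_sub zt => a b /and3P[]; rewrite !inE => /andP[ra la] /andP[rb lb] ab.
by apply: connect1; apply/and3P; rewrite !inE ra rb ab !(leq_trans _ le_zu).
Qed.

Lemma level_comp_eq u z : reach u -> z \in level_comp u -> level z = level u ->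
  level_comp z = level_comp u.
Proof.
move=> ru zu E; apply/eqP; rewrite eqEsubset level_comp_sub //=.
have [rz _] := level_compP ru zu; apply: level_comp_sub => //.
by move: zu; rewrite !inE E (sym_connect_sym (@induced_adj_sym _)).
Qed.

Lemma level_comp_edge u e x y : reach u -> ends e = [set x; y] -> x \in level_comp u ->
  level y <= level u -> y \in level_comp u.
Proof.
move=> ru E xu le_y; have [rx le_x] := level_compP ru xu.
move: xu; rewrite !inE => /connect_trans; apply; apply: connect1.
by apply: (induced_adj_intro E); rewrite inE ?rx ?(reach_edge E rx).
Qed.

(** Laminarity: the walk from [z] to [u] stays in the lower sublevel set, hence in the higher one,
    where [v] reaches [z]. *)
Lemma level_comp_nested u v z : reach u -> reach v -> z \in level_comp u ->
  z \in level_comp v -> level u <= level v -> level_comp u \subset level_comp v.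
Proof.
move=> ru rv zu zv le_uv; have [rz le_zu] := level_compP ru zu.
apply: level_comp_sub => //.
move: zu zv; rewrite !inE => zu zv; apply: connect_trans zv _.
apply: connect_sub (_ : connect (induced_adj (sublevel (level u))) z u).
  move=> a b /and3P[]; rewrite !inE => /andP[ra la] /andP[rb lb] ab.
  by apply: connect1; apply/and3P; rewrite !inE ra rb ab !(leq_trans _ le_uv).
by rewrite (sym_connect_sym (@induced_adj_sym _)).
Qed.

End Levels.

(** * Sebő's theorem *)

Section Sebo.
Variables (G : graph) (bipG : bipartite G) (U : {set vertex G}).
Implicit Types (u v x y z : vertex G) (D J F Q : {set edge G}) (e : edge G).
Local Notation reach := (reach U).
Local Notation level := (root_level U).
Local Notation level_comp := (level_comp U).
Local Notation minj v := (minimum_join (U :+: [set v])).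

(** Every edge is on the boundary of a colour class [A], so the size of a join has the parity of the
    number of its odd vertices in [A]. Moving the root along an edge changes that parity, while one
    edge changes the level by at most 1. *)
Lemma level_edge e x y : ends e = [set x; y] -> reach x ->
  level y = (level x).+1 \/ level x = (level y).+1.
Proof.
move=> E rx; have ry := reach_edge E rx.
have E' : ends e = [set y; x] by rewrite setUC.
have le1 := level_edge_le E rx; have le2 := level_edge_le E' ry.
suff : odd (level x) != odd (level y) by move: le1 le2; rewrite /Defs.nu; lia.
have [A hA] := bipG.
have oddj J : odd #|J| = odd #|odd_vertices J :&: A|.
  rewrite -card_boundary_parity; congr (odd _); apply: eq_card => f.
  by rewrite in_setI [X in _ && X]inE hA andbT.
have [F [_ FE <-]] := reach_level rx; have [F' [_ FE' <-]] := reach_level ry.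
rewrite !oddj FE FE' !symdiffIl !odd_card_symdiff.
have := hA e; rewrite (card_ends_in _ E).
have oddS z : odd #|[set z] :&: A| = (z \in A).
  case zA: (z \in A); first by rewrite (setIidPl _) ?cards1 ?sub1set.
  suff -> : [set z] :&: A = set0 by rewrite cards0.
  by apply/setP=> t; rewrite !inE; case: eqP => // ->.
by rewrite !oddS; case: (x \in A); case: (y \in A) => //= _; case: (odd _).
Qed.

(** An outer end of level at most [level u] would belong to the component; as levels change by
    exactly 1, both are forced. *)
Lemma level_comp_boundary u e x y : reach u -> ends e = [set x; y] ->
  x \in level_comp u -> y \notin level_comp u ->
  [/\ reach y, level x = level u & level y = (level u).+1].
Proof.
move=> ru E xu yu; have [rx le_x] := level_compP ru xu.
have ry := reach_edge E rx; split=> //.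
  by have := level_edge E rx; move: (contraNN (level_comp_edge ru E xu) yu); lia.
by have := level_edge E rx; move: (contraNN (level_comp_edge ru E xu) yu); lia.
Qed.

Definition level_comps : {set {set vertex G}} := [set level_comp u | u in [set u | reach u]].

(* An edge is on the boundary of the component of its lower end, and of no
   other level component. *)
Lemma card_level_comps_boundary J :
  (forall e x, e \in J -> x \in ends e -> reach x) ->
  #|J| = \sum_(K in level_comps) #|J :&: boundary K|.
Proof.
move=> rJ; rewrite -sum1_card.
have -> : \sum_(K in level_comps) #|J :&: boundary K| =
    \sum_(K in level_comps) \sum_(e in J) (e \in boundary K : nat).
  apply: eq_bigr => K _; rewrite -sum1_card big_mkcond /= [RHS]big_mkcond /=.
  by apply: eq_bigr => e _; rewrite in_setI; case: (e \in J) => //=; case: ifP.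
rewrite exchange_big /=; apply: eq_bigr => e eJ.
have [x [y [xy E]]] : exists x y, level y = (level x).+1 /\ ends e = [set x; y].
  have [x [y [_ E]]] := endsP e; have rx : reach x by apply: rJ eJ _; rewrite E !inE eqxx.
  by have [|] := level_edge E rx; [exists x, y | exists y, x; rewrite setUC].
have rx : reach x by apply: rJ eJ _; rewrite E !inE eqxx.
rewrite (bigD1 (level_comp x)) /=; last by rewrite imset_f // inE.
rewrite big1 ?addn0.
  suff -> : e \in boundary (level_comp x) by [].
  apply/boundaryP; exists x, y; split=> //; first exact: mem_level_comp.
  by apply/negP=> /(level_compP rx)[_]; lia.
move=> K /andP[/imsetP[z]]; rewrite inE => rz -> neq.
case: boundaryP => // -[a [b [E' az bz]]].
have [rb la lb] := level_comp_boundary rz E' az bz.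
have [] : a = x \/ a = y.
- by have : a \in ends e by [rewrite E' !inE eqxx]; rewrite E !inE => /orP[]/eqP; [left|right].
- by move=> ax; case/eqP: neq; rewrite -ax; apply/esym/level_comp_eq.
- move=> ay; have : x \in ends e by rewrite E !inE eqxx.
  by rewrite E' !inE => /orP[]/eqP xE; move: xy; rewrite xE -?ay; lia.
Qed.

(* The weight of [J] is the sum of its weights over the disjoint cuts given by
   the level components; an even cut with at most one negative edge has
   nonnegative weight. *)
Lemma even_cuts_weight F J :
  (forall e x, e \in J -> x \in ends e -> reach x) ->
  (forall u e, reach u -> e \in J -> e \in boundary (level_comp u) ->
     ~~ odd #|odd_vertices J :&: level_comp u| /\
     #|F :&: boundary (level_comp u)| <= 1) ->
  2 * #|F :&: J| <= #|J|.
Proof.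
move=> rJ cutJ; rewrite (card_level_comps_boundary rJ).
rewrite (@card_level_comps_boundary (F :&: J)); last first.
  by move=> e x; rewrite in_setI => /andP[_]; apply: rJ.
rewrite big_distrr /=; apply: leq_sum => K /imsetP[u]; rewrite inE => ru ->.
case: (set_0Vmem (J :&: boundary (level_comp u))) => [E|[e]].
  by rewrite -setIA E setI0 cards0.
rewrite in_setI => /andP[eJ eu]; have [] := cutJ u e ru eJ eu.
rewrite -card_boundary_parity => ev le1.
have : #|F :&: J :&: boundary (level_comp u)| <= 1.
  apply: leq_trans le1; rewrite subset_leq_card //.
  by apply/subsetP=> f; rewrite !in_setI -andbA => /and3P[-> _ ->].
have : 0 < #|J :&: boundary (level_comp u)|.
  by apply/card_gt0P; exists e; rewrite in_setI eJ.
by move: ev; lia.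
Qed.

Lemma symdiff_shift (A : {set vertex G}) a b :
  (A :+: [set a]) :+: (A :+: [set b]) = [set a] :+: [set b].
Proof. by apply/setP=> z; rewrite !in_symdiff; do 3!case: (z \in _). Qed.

(** Switching along [Q] exchanges the two roots and preserves the total size, so neither new join
    can exceed its minimum. *)
Lemma minj_switch a b F F' Q : minj a F -> minj b F' -> Q \subset F :+: F' ->
  odd_vertices Q = [set a] :+: [set b] -> minj b (F :+: Q).
Proof.
move=> mF mF' sQ QE.
have E1 := join_shift (minimum_joinP mF) QE.
have E2 : odd_vertices (F' :+: Q) = U :+: [set a].
  by apply: join_shift (minimum_joinP mF') _; rewrite QE symdiffC.
apply: minimum_join_intro => //.
have := level_le_card E2; have := card_symdiff_balance sQ.
rewrite (minimum_join_nu mF) (minimum_join_nu mF') /root_level; lia.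
Qed.

(** The result is [F'] inside [K] and [F] elsewhere. As neither join crosses the boundary, the odd
    vertices of the switched part are just [a] and [b]. *)
Lemma minj_exchange (K : {set vertex G}) a b F F' : minj a F -> minj b F' ->
  a \in K -> b \in K -> F :&: boundary K = set0 -> F' :&: boundary K = set0 ->
  minj b (F :+: ((F :+: F') :&: inner_edges K)).
Proof.
move=> mF mF' aK bK F0 F'0; apply: (minj_switch mF mF'); first exact: subsetIl.
rewrite odd_vertices_inner; last by rewrite symdiffIl F0 F'0 symdiff0.
rewrite odd_vertices_symdiff (minimum_joinP mF) (minimum_joinP mF') symdiff_shift.
by rewrite symdiffIl !(setIidPl _) ?sub1set.
Qed.

Lemma boundary_symdiff_inner (K K' : {set vertex G}) F D : K' \subset K ->
  D \subset inner_edges K' -> (F :+: D) :&: boundary K = F :&: boundary K.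
Proof.
move=> KK' DK; rewrite symdiffIl [X in _ :+: X](_ : _ = set0) ?symdiff0 //.
apply/setP=> e; rewrite in_setI in_set0; case eD: (e \in D) => //=; apply/negbTE.
apply: inner_not_boundary; rewrite inE; apply: subset_trans KK'.
by move/(subsetP DK): eD; rewrite inE.
Qed.

Lemma minj_reach v F : minj v F -> reach v.
Proof. by move=> /minimum_joinP; apply: reach_intro. Qed.

(** If [e] were in [F], deleting it would give a join rooted at the higher vertex [b] with fewer
    edges than [F]. *)
Lemma minj_add e a b F : ends e = [set a; b] -> minj a F -> level b = (level a).+1 ->
  e \notin F /\ minj b (F :+: [set e]).
Proof.
move=> E mF lb; have FE := join_shift_edge (minimum_joinP mF) E.
have eF : e \notin F.
  apply/negP=> eF; have := level_le_card FE; rewrite card_symdiff1 //.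
  by rewrite (minimum_join_nu mF) -[Defs.nu _]/(level a); lia.
split=> //; apply: minimum_join_intro => //; rewrite card_symdiff1N //.
by rewrite (minimum_join_nu mF) -[Defs.nu _]/(level a) -[Defs.nu _]/(level b) lb.
Qed.

Lemma minj_del e a b F : ends e = [set a; b] -> minj a F -> level a = (level b).+1 ->
  e \in F -> minj b (F :+: [set e]).
Proof.
move=> E mF lb eF; have FE := join_shift_edge (minimum_joinP mF) E.
apply: minimum_join_intro => //; rewrite card_symdiff1 //.
by rewrite (minimum_join_nu mF) -[Defs.nu _]/(level a) -[Defs.nu _]/(level b) lb.
Qed.

(** * The induction step of Sebő's theorem *)

Section Step.
Variable u : vertex G.
Hypothesis ru : reach u.
Local Notation K := (level_comp u).
Hypothesis IH : forall y v F, reach y -> level y < level u -> minj v F ->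
  #|F :&: boundary (level_comp y)| = (v \notin level_comp y).

(** A cut of a level component that contains an edge of [J] has its upper end in [K], so the
    component lies strictly below the top. Hence the induction hypothesis applies to it, and it
    contains no odd vertex of [J]. *)
Lemma top_weight v F J : minj v F -> J \subset inner_edges K ->
  (forall z, z \in odd_vertices J -> level z = level u) -> 2 * #|F :&: J| <= #|J|.
Proof.
move=> mF sJ topJ; apply: even_cuts_weight.
  move=> e x /(subsetP sJ); rewrite inE => /subsetP sK /sK xK.
  by have [] := level_compP ru xK.
move=> y e ry eJ /boundaryP[a [b [E ay by_]]].
have [rb la lb] := level_comp_boundary ry E ay by_.
have sK : ends e \subset K by move/(subsetP sJ): eJ; rewrite inE.
have bK : b \in K by rewrite (subsetP sK) // E !inE eqxx orbT.
have [_ le_b] := level_compP ru bK.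
have lt_y : level y < level u by clear -lb le_b; lia.
split; last by rewrite (IH ry lt_y mF) leq_b1.
suff -> : odd_vertices J :&: level_comp y = set0 by rewrite cards0.
apply/setP=> z; rewrite in_setI in_set0; apply/negP.
by move=> /andP[/topJ lz /(level_compP ry)[_]]; clear -lt_y lz; lia.
Qed.

(* If [F] does not use [e0], switch it along a weightless set through [e0]; were
   this set to end at a top vertex [q] other than [a], the boundary edge at [q]
   would give a join rooted at a vertex above [q] that is two edges too small. *)
Lemma trace_step_top e0 a b F : ends e0 = [set a; b] -> a \in K -> b \in K ->
  level a = level u -> level a = (level b).+1 -> minj a F ->
  exists2 F', minj b F' & F' :&: boundary K = F :&: boundary K.
Proof.
move=> E aK bK la lab mF.
have e0K : e0 \in inner_edges K by rewrite inE E subUset !sub1set aK.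
have trace1 D : D \subset inner_edges K -> (F :+: D) :&: boundary K = F :&: boundary K.
  exact: boundary_symdiff_inner.
case e0F: (e0 \in F).
  by exists (F :+: [set e0]); [exact: minj_del mF lab e0F | rewrite trace1 ?sub1set].
have E' : ends e0 = [set b; a] by rewrite setUC.
have [rb _] := level_compP ru bK.
(* A second minimum join rooted at [a], this one using [e0]; its difference [D] with [F] has no odd
   vertices. *)
have [Fb [mFb _ _]] := reach_level rb.
have [e0Fb mF1] := minj_add E' mFb lab.
set F1 := Fb :+: [set e0] in mF1.
have e0F1 : e0 \in F1 by rewrite in_symdiff (negPf e0Fb) inE eqxx.
set D := F :+: F1.
have bD : odd_vertices D = set0.
  rewrite odd_vertices_symdiff (minimum_joinP mF) (minimum_joinP mF1).
  by apply/setP=> z; rewrite in_symdiff addbb inE.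
(* All degrees in [D] are even, so a vertex that is odd in the inner part has an edge of [D] leaving
   [K], which puts it on the top level. *)
have outK q : q \in K -> q \in odd_vertices (D :&: inner_edges K) ->
    exists e y, [/\ e \in D, ends e = [set q; y], level q = level u & level y = (level u).+1].
  move=> qK qo.
  have : q \in odd_vertices (D :\: inner_edges K).
    by rewrite -symdiff_setI odd_vertices_symdiff in_symdiff qo bD inE.
  move=> /odd_vertices_edge[e]; rewrite in_setD => /andP[eK eD] qe.
  have [y qy Ee] := ends_at qe; exists e, y.
  have yK : y \notin K by apply: contra eK => yK; rewrite inE Ee subUset !sub1set qK.
  by have [] := level_comp_boundary ru Ee qK yK.
(* Removing [e0] makes [b] odd, since [b] is below the top. A set [Q'] from [b] to another odd
   vertex [q], completed by [e0], then leads from [a] to [q]. *)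
set Dm := (D :&: inner_edges K) :+: [set e0].
have DmE z : (z \in odd_vertices Dm) =
    (z \in odd_vertices (D :&: inner_edges K)) (+) (z \in [set a; b]).
  by rewrite odd_vertices_symdiff odd_vertices1 in_symdiff E.
have bDm : b \in odd_vertices Dm.
  rewrite DmE set22 addbT; apply/negP=> bo.
  by have [e [y [_ _ lb _]]] := outK b bK bo; clear -lb la lab; lia.
have [q [Q' [qDm qb sQ' bQ']]] := odd_vertices_pair bDm.
have e0D : e0 \in D by rewrite in_symdiff e0F e0F1.
have e0Q' : e0 \notin Q'.
  by apply/negP=> /(subsetP sQ'); rewrite in_symdiff in_setI e0D e0K inE eqxx.
have sQ'D : Q' \subset D :&: inner_edges K.
  apply/subsetP=> f fQ; move: (subsetP sQ' f fQ); rewrite in_symdiff [f \in [set e0]]inE.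
  by case: eqP => [fe|_]; rewrite ?addbF //; move: e0Q'; rewrite -fe fQ.
set Q := Q' :+: [set e0].
have sQ : Q \subset D :&: inner_edges K.
  apply/subsetP=> f; rewrite in_symdiff [f \in [set e0]]inE.
  case: eqP => [->|_]; first by rewrite in_setI e0D.
  by rewrite addbF => /(subsetP sQ'D).
have e0Q : e0 \in Q by rewrite in_symdiff (negPf e0Q') inE eqxx.
have bQ : odd_vertices Q = [set a] :+: [set q].
  rewrite odd_vertices_symdiff odd_vertices1 bQ' E'.
  rewrite symdiff_set2 1?eq_sym // symdiff_set2 ?(ends_neq E') //.
  by apply/setP=> z; rewrite !in_symdiff; do 3!case: (z \in _).
have qK : q \in K.
  have [f fD qf] := odd_vertices_edge qDm.
  have : f \in inner_edges K.
    move: fD; rewrite in_symdiff in_setI in_set1.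
    by case: eqP => [->|_ /=]; rewrite ?addbF // => /andP[].
  by rewrite inE => /subsetP; apply.
have qout : q != a -> q \in odd_vertices (D :&: inner_edges K).
  by move: qDm => /[swap] qa; rewrite DmE in_set2 (negPf qa) (negPf qb) addbF.
have lq : level q = level u.
  case: (eqVneq q a) => [->//|/qout qo]; by have [e [y []]] := outK q qK qo.
have sQK : Q \subset inner_edges K by apply: subset_trans sQ (subsetIr _ _).
have topQ z : z \in odd_vertices Q -> level z = level u.
  by rewrite bQ in_symdiff !in_set1; do 2![case: eqP => [->|_] //].
(* [Q] lies in the difference of [F] and [F1], so its two weights sum to zero; both being
   nonnegative, both vanish. *)
have w1 := top_weight mF sQK topQ; have w2 := top_weight mF1 sQK topQ.
have sQD : Q \subset D by apply: subset_trans sQ (subsetIl _ _).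
have bal := card_symdiff_balance sQD.
have cF := card_symdiff F Q; have cF1 := card_symdiff F1 Q.
have nF := minimum_join_nu mF; have nF1 := minimum_join_nu mF1.
rewrite -[Defs.nu _]/(level a) in nF nF1.
have FQ : #|F :+: Q| = level a by clear -w1 w2 bal cF cF1 nF nF1; lia.
have F1Q : #|F1 :+: Q| = level a by clear -w1 w2 bal cF cF1 nF nF1; lia.
case: (eqVneq q a) => [qa|qa].
  have mFQ : minj a (F :+: Q).
    apply: minimum_join_intro; last by rewrite FQ.
    rewrite odd_vertices_symdiff (minimum_joinP mF) bQ qa.
    by apply/setP=> z; rewrite !in_symdiff addbb addbF.
  exists (F :+: Q :+: [set e0]); last first.
    by rewrite -symdiffA symdiffK trace1 // (subset_trans sQ'D) ?subsetIr.
  by apply: minj_del mFQ lab _ => //; rewrite in_symdiff e0F e0Q.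
exfalso; have [e [y [eD Ee _ ly]]] := outK q qK (qout qa).
have yK : y \notin K by apply/negP=> /(level_compP ru)[_]; clear -ly; lia.
have eQ : e \notin Q.
  by apply/negP=> /(subsetP sQK); rewrite inE Ee subUset !sub1set (negPf yK) andbF.
(* One of [F] and [F1] contains [e]. Switched along [Q] and stripped of [e], it is rooted at [y] and
   has [level a] minus one edges, whereas [level y] is [level a] plus one. *)
have small F2 : minj a F2 -> e \in F2 -> #|F2 :+: Q| = level a -> False.
  move=> mF2 eF2 c2.
  have FE := join_shift_edge (join_shift (minimum_joinP mF2) bQ) Ee.
  have eF2Q : e \in F2 :+: Q by rewrite in_symdiff eF2 (negPf eQ).
  have := level_le_card FE; rewrite card_symdiff1 //.
  by rewrite c2; clear -la lab ly; lia.
move: eD; rewrite in_symdiff; case eF: (e \in F); first by move=> _; exact: (small F mF eF FQ).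
by move=> eF1; exact: (small F1 mF1 eF1 F1Q).
Qed.

(** An upward edge is simply added, and a downward edge from the top is the previous lemma. Below
    the top, the component of [a] contains [b] and by induction is crossed by neither join, so the
    exchange can be made inside it. *)
Lemma trace_step e0 a b F : ends e0 = [set a; b] -> a \in K -> b \in K -> minj a F ->
  exists2 F', minj b F' & F' :&: boundary K = F :&: boundary K.
Proof.
move=> E aK bK mF; have [ra le_a] := level_compP ru aK; have [rb _] := level_compP ru bK.
have e0K : e0 \in inner_edges K by rewrite inE E subUset !sub1set aK.
have [lb|la] := level_edge E ra.
  exists (F :+: [set e0]); first by have [] := minj_add E mF lb.
  by rewrite (@boundary_symdiff_inner _ K) ?sub1set.
have [top|lt_a] := eqVneq (level a) (level u); first exact: trace_step_top E aK bK top la mF.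
have {}lt_a : level a < level u by clear -lt_a le_a; lia.
have [Fb [mFb _ _]] := reach_level rb.
have ba : b \in level_comp a.
  by apply: level_comp_edge E (mem_level_comp _ _) _ => //; clear -la; lia.
have aa := mem_level_comp U a.
have /eqP := IH ra lt_a mF; rewrite aa cards_eq0 => /eqP F0.
have /eqP := IH ra lt_a mFb; rewrite ba cards_eq0 => /eqP Fb0.
exists (F :+: ((F :+: Fb) :&: inner_edges (level_comp a))).
  exact: minj_exchange mF mFb aa ba F0 Fb0.
by rewrite (@boundary_symdiff_inner _ (level_comp a)) ?subsetIr ?level_comp_sub.
Qed.

(** If [F] used a boundary edge, moving the root through [K] to the inner end of that edge would
    keep it in the join, against [minj_add]. *)
Lemma no_boundary_inside v F : v \in K -> minj v F -> F :&: boundary K = set0.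
Proof.
move=> vK mF; apply/setP=> e; rewrite in_setI in_set0; apply/negP=> /andP[eF eK].
have /boundaryP[x [y [E xK yK]]] := eK.
(* Walks in the sublevel set that start in [K] never leave it, so [K] is connected through its own
   vertices. *)
have : connect (induced_adj K) v x.
  have toK z : z \in K -> connect (induced_adj K) u z.
    rewrite inE => /connectP[p]; elim/last_ind: p z => [z _ ->//|p t IHp z].
    rewrite rcons_path last_rcons => /andP[pp pt] ->.
    have lp := IHp _ pp erefl; apply: connect_trans lp (connect1 _).
    case/and3P: pt => lpS tS /existsP[f /eqP Ef].
    have lpK : last u p \in K by rewrite inE; apply/connectP; exists p.
    apply: (induced_adj_intro Ef) => //.
    by apply: level_comp_edge Ef lpK _ => //; move: tS; rewrite inE => /andP[].
  apply: connect_trans (toK _ xK).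
  by rewrite (sym_connect_sym (@induced_adj_sym _ _)) toK.
move=> /connectP[p]; elim: p v vK F mF eF => [|w p IHp] v vK F mF eF /=.
  move=> _ xv; rewrite -xv in mF.
  have [ry lx ly] := level_comp_boundary ru E xK yK.
  have lxy : level y = (level x).+1 by rewrite ly lx.
  by have [/negP] := minj_add E mF lxy.
move=> /andP[/and3P[_ wK /existsP[f /eqP Ef]] pp] xl.
have [F' mF' tr] := trace_step Ef vK wK mF.
apply: (IHp w wK F' mF' _ pp xl).
by move/setP: tr => /(_ e); rewrite !in_setI eF eK andbT => ->.
Qed.

(** Parity gives at least one boundary edge. Switching [F] along a set [Q] that leads from [v] into
    [K] and crosses the boundary only at [e] gives a minimum join rooted in [K], which has no
    boundary edge; hence [F] has none besides [e]. *)
Lemma one_boundary_outside v F : v \notin K -> minj v F -> #|F :&: boundary K| = 1.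
Proof.
move=> vK mF; have uK := mem_level_comp U u.
have [Fu [mFu _ _]] := reach_level ru.
have Fu0 := no_boundary_inside uK mFu.
have uv : u != v by apply: contraNneq vK => <-.
set D := F :+: Fu.
have bD : odd_vertices D = [set v] :+: [set u].
  by rewrite odd_vertices_symdiff (minimum_joinP mF) (minimum_joinP mFu) symdiff_shift.
have DK e : e \in boundary K -> (e \in D) = (e \in F).
  move=> eK; rewrite in_symdiff; move/setP: Fu0 => /(_ e).
  by rewrite in_setI eK in_set0 andbT => ->; rewrite addbF.
have oddF : odd #|F :&: boundary K|.
  have : odd #|D :&: boundary K|.
    rewrite card_boundary_parity bD symdiffIl odd_card_symdiff.
    rewrite [[set u] :&: K](setIidPl _) ?sub1set // cards1.
    suff -> : [set v] :&: K = set0 by rewrite cards0.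
    by apply/setP=> z; rewrite in_setI in_set1 in_set0; case: eqP => // ->; rewrite (negPf vK).
  congr (odd _); apply: eq_card => e; rewrite !in_setI.
  by case eK: (e \in boundary K); rewrite ?andbF // DK.
have [Q [e [q [sQD bQ qK QK eQ]]]] : exists Q e q,
    [/\ Q \subset D, odd_vertices Q = [set v] :+: [set q], q \in K,
        forall f, f \in Q -> f \in boundary K -> f = e
        & forall f, f \in Q -> f \notin inner_edges K].
  (* The edges of [D] missing [K]. If no edge of [D] joins [v] directly to [K], then [v] is odd in
     [D0]; its partner [y] is even in [D], so some edge of [D] leads from [y] into [K]. *)
  set D0 := [set f in D | [disjoint ends f & K]].
  have D0B z f : z \notin K -> z \in ends f -> f \in D -> f \notin D0 -> 
      exists2 q, ends f = [set z; q] & q \in K.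
    move=> zK zf fD; have [q zq Ef] := ends_at zf; rewrite inE fD /= => nd.
    exists q => //; apply: contraNT nd => qK; rewrite disjoints_subset Ef.
    by rewrite subUset !sub1set !in_setC zK.
  case: (boolP [exists e in D :\: D0, v \in ends e]).
    move=> /existsP[e /andP[]]; rewrite in_setD => /andP[eD0 eD] ve.
    have [q Ee qK] := D0B v e vK ve eD eD0.
    exists [set e], e, q; split=> //; first by rewrite sub1set.
    - by rewrite odd_vertices1 Ee symdiff_set2 // (ends_neq Ee).
    - by move=> f /set1P.
    - by move=> f /set1P->; rewrite inE Ee subUset !sub1set (negPf vK).
  move=> nex; have vD0 : v \in odd_vertices D0.
    rewrite (@odd_verticesE _ _ D) ?bD ?in_symdiff ?inE ?eqxx 1?eq_sym ?(negPf uv) //.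
    move=> e ve; apply/idP/idP => [|eD]; first by rewrite inE => /andP[].
    by apply: contraNT nex => eD0; apply/existsP; exists e; rewrite in_setD eD0 eD.
  have [y [Q' [yD0 yv sQ' bQ']]] := odd_vertices_pair vD0.
  have D0K f : f \in D0 -> forall z, z \in ends f -> z \notin K.
    by rewrite inE => /andP[_ /disjointFr nd] z /nd ->.
  have yK : y \notin K by have [f fD0 yf] := odd_vertices_edge yD0; apply: D0K yf.
  have yu : y != u by apply: contraNneq yK => ->.
  have : y \in odd_vertices (D :\: D0).
    have -> : D :\: D0 = D :+: D0.
      rewrite -symdiff_setI (setIidPr _) //.
      by apply/subsetP=> f; rewrite inE => /andP[].
    by rewrite odd_vertices_symdiff in_symdiff yD0 bD in_symdiff !inE (negPf yv) (negPf yu).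
  move=> /odd_vertices_edge[e]; rewrite in_setD => /andP[eD0 eD] ye.
  have [q Ee qK] := D0B y e yK ye eD eD0.
  have Q'E f : f \in Q' :+: [set e] -> f = e \/ f \in D0.
    rewrite in_symdiff in_set1; case: eqP; first by left.
    by rewrite addbF => _ /(subsetP sQ'); right.
  exists (Q' :+: [set e]), e, q; split=> //.
  - by apply/subsetP=> f /Q'E[->//|]; rewrite inE => /andP[].
  - rewrite odd_vertices_symdiff odd_vertices1 bQ' Ee.
    rewrite symdiff_set2 1?eq_sym // symdiff_set2 ?(ends_neq Ee) //.
    by apply/setP=> z; rewrite !in_symdiff; do 3!case: (z \in _).
  - move=> f /Q'E[//|/D0K fK] /boundaryP[a [b [Ef aK _]]].
    have af : a \in ends f by rewrite Ef set21.
    by move: (fK a af); rewrite aK.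
  - move=> f /Q'E[->|/D0K fK]; first by rewrite inE Ee subUset !sub1set (negPf yK).
    have [a [b [_ Ef]]] := endsP f; rewrite inE Ef subUset !sub1set.
    by rewrite (negPf (fK a _)) // Ef !inE eqxx.
have [rq _] := level_compP ru qK; have [Fq [mFq _ _]] := reach_level rq.
have Fq0 := no_boundary_inside qK mFq.
(* Rerouting [Fu] inside [K] roots it at [q]. As [Q] has no inner edges, it stays in the difference
   with [F]. *)
have mF2 := minj_exchange mFu mFq uK qK Fu0 Fq0.
set F2 := (X in minj q X) in mF2.
have sQ2 : Q \subset F :+: F2.
  apply/subsetP=> f fQ; move: (subsetP sQD f fQ).
  by rewrite /D /F2 !in_symdiff in_setI (negPf (eQ f fQ)) andbF addbF.
have mFQ := minj_switch mF mF2 sQ2 bQ.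
have FQ0 := no_boundary_inside qK mFQ.
apply/eqP; rewrite eqn_leq odd_gt0 // andbT.
rewrite -(cards1 e) subset_leq_card //; apply/subsetP=> f; rewrite in_setI => /andP[fF fK].
rewrite inE; apply/eqP/QK => //.
by move/setP: FQ0 => /(_ f); rewrite in_setI fK andbT in_symdiff fF in_set0; case: (f \in Q).
Qed.

End Step.

Theorem card_join_boundary u v F : reach u -> minj v F ->
  #|F :&: boundary (level_comp u)| = (v \notin level_comp u).
Proof.
elim: {u}_.+1 {-2}u (ltnSn (level u)) v F => // n IHn u le_n v F ru mF.
have IH y v' F' : reach y -> level y < level u -> minj v' F' ->
    #|F' :&: boundary (level_comp y)| = (v' \notin level_comp y).
  by move=> ry lt_y; apply: IHn => //; lia.
case vK: (v \in level_comp u); last by rewrite (one_boundary_outside ru IH _ mF) ?vK.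
by rewrite (no_boundary_inside ru IH vK mF) cards0.
Qed.

End Sebo.

(** * Distances and levels *)

Section Walks.
Variable G : graph.
Implicit Types (x y z : vertex G) (J F : {set edge G}) (p : seq (edge G * vertex G)).

Definition edge_adj J : rel (vertex G) := [rel x y | [exists e in J, ends e == [set x; y]]].

Lemma edge_adj_intro J e x y : e \in J -> ends e = [set x; y] -> edge_adj J x y.
Proof. by move=> eJ E; apply/existsP; exists e; rewrite eJ E eqxx. Qed.

Lemma odd_vertices_connect J x y : odd_vertices J = [set x; y] -> connect (edge_adj J) x y.
Proof.
elim: {J}_.+1 {-2}J (ltnSn #|J|) x => // n IHn J lt_n x bJ.
have [->|xy] := eqVneq x y; first exact: connect0.
have [e eJ xe] : exists2 e, e \in J & x \in ends e.
  by apply: odd_vertices_edge; rewrite bJ set21.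
have [z xz E] := ends_at xe.
apply: connect_trans (connect1 (edge_adj_intro eJ E)) _.
have [->|zy] := eqVneq z y; first exact: connect0.
have sub : connect (edge_adj (J :+: [set e])) z y -> connect (edge_adj J) z y.
  apply: connect_sub => a b /existsP[f /andP[fJ /eqP Ef]].
  apply/connect1/(edge_adj_intro _ Ef).
  by move: fJ; rewrite in_symdiff in_set1; case: eqP => [->//|_]; rewrite addbF.
apply/sub/IHn.
  by rewrite card_symdiff1 //; have : 0 < #|J| by [apply/card_gt0P; exists e]; lia.
rewrite odd_vertices_symdiff odd_vertices1 bJ E !symdiff_set2 //.
by apply/setP=> t; rewrite !in_symdiff; do 3!case: (t \in _).
Qed.

Lemma edge_adj_path J x y : connect (edge_adj J) x y ->
  exists2 p, is_path x y p & {subset unzip1 p <= J}.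
Proof.
move=> /connectP[p0]; case/shortenP=> p pp up _ ->.
suff [w [ww w2 w1]] : exists w, [/\ is_walk x w, unzip2 w = p & {subset unzip1 w <= J}].
  by exists w => //; rewrite /is_path ww w2 up eqxx.
elim: p x pp {up} => [|z p IHp] x /=; first by exists [::].
move=> /andP[/existsP[e /andP[eJ E]] /IHp[w [ww w2 w1]]].
exists ((e, z) :: w); rewrite /= E ww w2; split=> // f.
by rewrite inE => /orP[/eqP->//|/w1].
Qed.

Lemma path_edges F x y p : is_path x y p ->
  odd_vertices [set e in unzip1 p] = [set x] :+: [set y] /\
  (#|F :+: [set e in unzip1 p]|%:Z = #|F|%:Z + weight F p)%R.
Proof.
move=> /and3P[pw pu /eqP <-] {y}.
(* The clause on ends shows that the first edge of the walk does not recur, because its starting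
   vertex does not. *)
suff [] : (forall e z, e \in unzip1 p -> z \in ends e -> z \in x :: unzip2 p) /\
  odd_vertices [set e in unzip1 p] = [set x] :+: [set last x (unzip2 p)] /\
  (#|F :+: [set e in unzip1 p]|%:Z = #|F|%:Z + weight F p)%R by [].
elim: p x pw pu => [|[e y] p IHp] x /=.
  move=> _ _; have -> : [set e in ([::] : seq (edge G))] = set0.
    by apply/setP=> e; rewrite inE.
  rewrite symdiff0 /weight big_nil GRing.addr0; split=> //; split=> //.
  apply/setP=> z; rewrite in_symdiff addbb; apply/negP=> /odd_vertices_edge[e].
  by rewrite inE.
move=> /andP[/eqP E pw] /andP[xp pu]; have [IHe [IHo IHw]] := IHp y pw pu.
have ep : e \notin unzip1 p.
  by apply: contra xp => ep; apply: IHe ep _; rewrite E set21.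
have -> : [set f in e :: unzip1 p] = [set f in unzip1 p] :+: [set e].
  apply/setP=> f; rewrite in_symdiff !inE; case: eqP => [->|_]; rewrite ?addbF //.
  by rewrite (negPf ep).
split.
  move=> f z; rewrite inE => /orP[/eqP->|/IHe H /H zp]; last by rewrite in_cons zp orbT.
  by rewrite E !inE => /orP[->|->]; rewrite ?orbT.
split.
  rewrite odd_vertices_symdiff IHo odd_vertices1 E symdiff_set2 ?(ends_neq E) //.
  by apply/setP=> z; rewrite !in_symdiff; do 3!case: (z \in _).
rewrite symdiffA /weight big_cons /= -[X in (_ + (_ + X))%R]/(weight F p).
have eE : (e \in F :+: [set f in unzip1 p]) = (e \in F).
  by rewrite in_symdiff [X in _ (+) X]inE (negPf ep) addbF.
case eF: (e \in F).
  have : 0 < #|F :+: [set f in unzip1 p]| by apply/card_gt0P; exists e; rewrite eE.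
  rewrite card_symdiff1 ?eE //; move: IHw; clear.
  by move: #|_ :+: _| #|F| (weight F p) => a b c; lia.
rewrite card_symdiff1N ?eE ?eF //; move: IHw; clear.
by move: #|_ :+: _| #|F| (weight F p) => a b c; lia.
Qed.

End Walks.

Section Distance.
Variables (G : graph) (bipG : bipartite G) (T : {set vertex G}) (F : {set edge G}).
Hypothesis mF : minimum_join T F.
Variable r : vertex G.
Local Notation U := (T :+: [set r]).
Local Notation reach := (reach U).
Local Notation level := (root_level U).
Local Notation level_comp := (level_comp U).
Implicit Types x y z u v : vertex G.

Lemma minj_root F' : minimum_join T F' -> minimum_join (U :+: [set r]) F'.
Proof. by rewrite symdiffK. Qed.

Lemma reach_root : reach r.
Proof. exact: minj_reach (minj_root mF). Qed.

(** Switching [F] along a path adds its weight to the size, which gives the lower bound. It is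
    attained by a path inside the difference of [F] and a minimum join rooted at [x], by
    [minj_switch]. *)
Lemma dist_reach x : reach x -> dist F r x = ((level x)%:Z - (nu T)%:Z)%:E%E.
Proof.
move=> rx; have mFr := minj_root mF.
have nF := minimum_join_nu mF.
have lower p : is_path r x p -> ((level x)%:Z - (nu T)%:Z <= weight F p)%R.
  move=> pp; have [bp wp] := path_edges F pp.
  have := level_le_card (join_shift (minimum_joinP mFr) bp).
  by rewrite -nF; lia.
have [p pp wp] : exists2 p, is_path r x p & weight F p = ((level x)%:Z - (nu T)%:Z)%R.
  have [<-|neq] := eqVneq r x.
    exists [::]; first by rewrite /is_path /= eqxx.
    by rewrite /weight big_nil /root_level symdiffK GRing.subrr.
  have [Fx [mFx _ _]] := reach_level rx.
  have [|p pp sp] := edge_adj_path (@odd_vertices_connect _ (F :+: Fx) r x _).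
    rewrite odd_vertices_symdiff (minimum_joinP mFr) (minimum_joinP mFx) symdiff_shift.
    by rewrite symdiff_set2.
  exists p => //; have [bp wp] := path_edges F pp.
  have /minimum_join_nu : minimum_join (U :+: [set x]) (F :+: [set e in unzip1 p]).
    apply: minj_switch mFr mFx _ bp.
    by apply/subsetP=> e; rewrite inE => /sp.
  by rewrite /root_level; lia.
have := dist_le F pp; have [q qp ->] := dist_attained F pp.
by rewrite lee_fin -wp => le1; congr (_%:E)%E; apply/le_anti; rewrite le1 wp lower.
Qed.

Lemma dist_unreach x : ~~ reach x -> dist F r x = +oo%E.
Proof.
move=> nrx; apply: (big_ind (fun z : \bar int => z = +oo%E)) => //.
  by move=> a b -> ->; rewrite minxx.
move=> n _; rewrite big_pred0 // => p; apply/negP=> pp; case/negP: nrx.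
have [bp _] := path_edges F pp.
exact: reach_intro (join_shift (minimum_joinP (minj_root mF)) bp).
Qed.

Lemma level_leP x i :
  (x \in level_le F r i) = reach x && ((level x)%:Z - (nu T)%:Z <= i)%R.
Proof.
rewrite inE; case rx: (reach x) => /=; first by rewrite dist_reach // lee_fin.
by rewrite dist_unreach ?rx.
Qed.

(** A highest vertex of [C] serves as [u]. The closure condition on [X] holds both for the sublevel
    sets defining distance components and for D(K). *)
Lemma components_level_comp (X C : {set vertex G}) :
  (forall x, x \in X -> reach x) ->
  (forall e a b w, ends e = [set a; b] -> a \in X -> w \in X -> level b <= level w -> b \in X) ->
  C \in components X -> exists u, [/\ u \in C, reach u & C = level_comp u].
Proof.
move=> rX downX /imsetP[x xX CE].
have xC : x \in C by rewrite CE inE xX connect0.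
have CX z : z \in C -> z \in X by rewrite CE inE => /andP[].
have [u uC maxu] := @arg_maxnP _ x (mem C) level xC.
have ru : reach u by apply/rX/CX.
have Cu z : (z \in C) = connect (induced_adj X) u z.
  move: uC; rewrite CE !inE => /andP[uX xu].
  rewrite (same_connect (sym_connect_sym (@induced_adj_sym _ X)) xu).
  by case: (boolP (connect _ _ _)) => uz; rewrite ?andbF // andbT (connect_induced_adj_mem uz).
exists u; split=> //; apply/setP=> z; rewrite inE; apply/idP/idP.
  rewrite Cu => /connectP[p]; elim/last_ind: p z => [|p t IHp] z /=; first by move=> _ ->.
  rewrite rcons_path last_rcons => /andP[pp pt] ->.
  apply: connect_trans (IHp _ pp erefl) (connect1 _).
  case/and3P: (pt) => lX tX /existsP[e /eqP E].
  have lC : last u p \in C by rewrite Cu; apply/connectP; exists p.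
  have tC : t \in C.
    by move: lC; rewrite !Cu => /connect_trans; apply; apply: connect1.
  by apply: (induced_adj_intro E); rewrite inE rX //; apply: maxu.
move=> /connectP[p]; elim/last_ind: p z => [|p t IHp] z /=; first by move=> _ ->.
rewrite rcons_path last_rcons => /andP[pp /and3P[lX tX /existsP[e /eqP E]]] ->.
have lC := IHp _ pp erefl; have lX' := CX _ lC.
have tX' : t \in X.
  apply: downX E (CX _ lC) (CX _ uC) _.
  by move: tX; rewrite inE => /andP[].
move: lC; rewrite !Cu => /connect_trans; apply; apply: connect1.
exact: (induced_adj_intro E).
Qed.

Lemma distance_component_level_comp K : distance_component F r K ->
  exists2 u, reach u & K = level_comp u.
Proof.
case=> i _ /(components_level_comp _ _)[||u [_ ru ->]]; last by exists u.
  by move=> x; rewrite level_leP => /andP[].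
move=> e a b w E; rewrite !level_leP => /andP[ra _] /andP[rw lw] le_bw.
by rewrite (reach_edge E ra) /=; apply: le_trans lw; lia.
Qed.

Lemma Aset_level_comp u x : reach u ->
  (x \in Aset F r (level_comp u)) = (x \in level_comp u) && (level x == level u).
Proof.
move=> ru; rewrite [LHS]inE; case xu: (x \in level_comp u) => //=.
have [rx le_x] := level_compP ru xu.
apply/forallP/eqP => [/(_ u)|lx y].
  by rewrite mem_level_comp /= !dist_reach // lee_fin; lia.
apply/implyP=> yu; have [ry le_y] := level_compP ru yu.
by rewrite !dist_reach // lee_fin lx; lia.
Qed.

Lemma Dset_level_comp u x : reach u ->
  (x \in Dset F r (level_comp u)) = (x \in level_comp u) && (level x < level u).
Proof.
move=> ru; rewrite in_setD Aset_level_comp //; case xu: (x \in level_comp u) => //=.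
by have [rx le_x] := level_compP ru xu; lia.
Qed.

Lemma Dset_component u C : reach u -> C \in components (Dset F r (level_comp u)) ->
  exists w, [/\ w \in Dset F r (level_comp u), reach w & C = level_comp w].
Proof.
move=> ru Cc.
have [||w [wC rw CE]] := components_level_comp _ _ Cc.
- by move=> x; rewrite Dset_level_comp // => /andP[/(level_compP ru)[]].
- move=> e a b w E; rewrite !Dset_level_comp // => /andP[au la] /andP[wu lw] le_bw.
  have lb : level b < level u by lia.
  by rewrite lb (level_comp_edge ru E au) //; lia.
exists w; split=> //.
by case/imsetP: Cc wC => x _ ->; rewrite inE => /andP[].
Qed.

End Distance.

(** * The classes of a bipartite graft *)

Section Classes.
Variables (G : graph) (bipG : bipartite G) (T : {set vertex G}) (F : {set edge G}).
Hypothesis mF : minimum_join T F.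
Implicit Types (x y z u v r : vertex G) (e : edge G) (S C : {set vertex G}).
Local Notation fc := (factor_connected T).

Lemma allowedP e : reflect (exists2 F', minimum_join T F' & e \in F') (allowed T e).
Proof.
apply: (iffP existsP) => [[F' /andP[]]|[F' mF' eF']]; first by exists F'.
by exists F'; rewrite mF'.
Qed.

Lemma allowed_adj_intro e x y : allowed T e -> ends e = [set x; y] -> allowed_adj T x y.
Proof. by move=> ae E; apply/existsP; exists e; rewrite ae E eqxx. Qed.

Lemma allowed_adjP x y :
  reflect (exists2 e, allowed T e & ends e = [set x; y]) (allowed_adj T x y).
Proof.
apply: (iffP existsP) => [[e /andP[ae /eqP E]]|[e ae E]]; first by exists e.
by exists e; rewrite ae E eqxx.
Qed.

Lemma allowed_adj_sym : symmetric (allowed_adj T).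
Proof.
by move=> x y; apply: eq_existsb => e; rewrite setUC.
Qed.

Lemma factor_connected_sym : symmetric fc.
Proof. exact: sym_connect_sym allowed_adj_sym. Qed.

Lemma factor_connected_trans : transitive fc.
Proof. exact: connect_trans. Qed.

Lemma factor_componentE C x : factor_component T C -> x \in C -> {in C, forall y, fc x y}.
Proof.
move=> /maxsetp /forallP/(_ x) /implyP H xC y yC.
by have /forallP/(_ y) /implyP := H xC; apply.
Qed.

Lemma factor_componentP x y :
  reflect (exists C, [/\ factor_component T C, x \in C & y \in C]) (fc x y).
Proof.
apply: (iffP idP) => [xy|[C [Cc xC yC]]]; last exact: (factor_componentE Cc xC).
have xx : fc x x by exact: connect0.
exists [set z | fc x z]; split; rewrite ?inE //.
apply/maxsetP; split.
  apply/forallP=> a; apply/implyP; rewrite inE => xa; apply/forallP=> b; apply/implyP.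
  by rewrite inE => xb; apply: factor_connected_trans xb; rewrite factor_connected_sym.
move=> B /forallP HB sB; apply/eqP; rewrite eqEsubset sB andbT; apply/subsetP=> z zB.
have xB : x \in B by rewrite (subsetP sB) // inE; apply: connect0.
by rewrite inE; have /implyP/(_ xB)/forallP/(_ z)/implyP := HB x; apply.
Qed.

Lemma factor_connected_exit (X : {set vertex G}) x y : fc x y -> x \in X -> y \notin X ->
  exists e a b, [/\ allowed T e, ends e = [set a; b], a \in X, b \notin X & fc x a /\ fc b y].
Proof.
move=> /connectP[p]; elim: p x => [|z p IHp] x /=; first by move=> _ -> ->.
move=> /andP[xz pp] yl xX yX; have /allowed_adjP[e ae E] := xz.
case zX: (z \in X).
  have [f [a [b [af Ef aX bX [za bY]]]]] := IHp z pp yl zX yX.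
  exists f, a, b; split=> //; split=> //; apply: connect_trans za; exact: connect1.
exists e, x, z; split=> //; rewrite ?zX //; split; first exact: connect0.
by apply/connectP; exists p.
Qed.

(** With [x] as the root, its own level component contains the root, so no minimum join of [T]
    crosses its boundary and no allowed edge leaves it. *)
Lemma factor_connected_level_comp x y : fc x y -> y \in level_comp (T :+: [set x]) x.
Proof.
move=> xy; apply/negPn/negP=> yK.
have [e [a [b [/allowedP[F' mF' eF'] E aK bK _]]]] :=
  factor_connected_exit xy (mem_level_comp _ x) yK.
have rx := reach_root mF x.
have /eqP := card_join_boundary bipG rx (minj_root x mF').
rewrite mem_level_comp cards_eq0 => /eqP/setP/(_ e).
by rewrite in_setI eF' in_set0 /= => /negP; apply; apply/boundaryP; exists a, b.
Qed.

Lemma factor_connected_nu x y : fc x y -> nu (T :+: [set x] :+: [set y]) <= nu T.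
Proof.
move=> /factor_connected_level_comp /(level_compP (reach_root mF x))[_].
by rewrite /root_level symdiffK.
Qed.

(** A level component containing one of the top vertices [x], [y] contains all of the component of
    [u], hence both. So every cut is even for the difference of [F] and a competing join, and cut
    counting gives nonnegative weight. *)
Lemma top_level_nu r u x y : reach (T :+: [set r]) u ->
  x \in level_comp (T :+: [set r]) u -> y \in level_comp (T :+: [set r]) u ->
  root_level (T :+: [set r]) x = root_level (T :+: [set r]) u ->
  root_level (T :+: [set r]) y = root_level (T :+: [set r]) u ->
  nu T <= nu (T :+: [set x] :+: [set y]).
Proof.
set U := T :+: [set r] => ru xu yu lx ly.
have nF := minimum_join_nu mF; rewrite -nF.
apply: nu_ge => [|J']; first exact: max_card.
rewrite is_joinE => /eqP bJ'; set J := F :+: J'.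
have bJ : odd_vertices J = [set x] :+: [set y].
  rewrite odd_vertices_symdiff (minimum_joinP mF) bJ'.
  by apply/setP=> z; rewrite !in_symdiff; do 3!case: (z \in _).
have [rx _] := level_compP ru xu; have [ry _] := level_compP ru yu.
(* Levels are meaningful only on [R], which no edge leaves; cut counting is applied to the part of
   [J] inside it. *)
set R := [set z | reach U z].
have J0 : J :&: boundary R = set0.
  apply/setP=> e; rewrite in_setI in_set0; apply/negP=> /andP[_ /boundaryP[a [b [E]]]].
  by rewrite !inE => ra /negP; apply; apply: reach_edge E ra.
set J1 := J :&: inner_edges R.
have bJ1 : odd_vertices J1 = [set x] :+: [set y].
  by rewrite odd_vertices_inner // bJ symdiffIl !(setIidPl _) // sub1set inE.
have sep z z' w : z \in level_comp U u -> z' \in level_comp U u ->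
    root_level U z = root_level U u -> reach U w -> z \in level_comp U w -> z' \in level_comp U w.
  move=> zu z'u lz rw zw; have [_] := level_compP rw zw; rewrite lz => le_uw.
  exact: (subsetP (level_comp_nested ru rw zu zw le_uw)).
have w1 : 2 * #|F :&: J1| <= #|J1|.
  apply: (even_cuts_weight bipG (U := U)).
    by move=> e z; rewrite in_setI => /andP[_]; rewrite inE => /subsetP sR /sR; rewrite inE.
  move=> w e rw eJ ew; split.
    rewrite bJ1 symdiffIl odd_card_symdiff.
    have card1 z : #|[set z] :&: level_comp U w| = (z \in level_comp U w).
      case zw: (z \in _); first by rewrite (setIidPl _) ?sub1set ?cards1.
      suff -> : [set z] :&: level_comp U w = set0 by rewrite cards0.
      by apply/setP=> t; rewrite in_setI in_set1 in_set0; case: eqP => // ->.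
    have -> : #|[set x] :&: level_comp U w| = #|[set y] :&: level_comp U w|.
      rewrite !card1; congr nat_of_bool; apply/idP/idP; exact: sep.
    by rewrite addbb.
  by rewrite (card_join_boundary bipG rw (minj_root r mF)) leq_b1.
(* The rest of [J] has no odd vertices, so switching [F] along it gives a join of [T], and
   minimality bounds its weight. *)
have c2 : #|F| <= #|F :+: (J :+: J1)|.
  apply: minimum_join_le mF _; rewrite is_joinE odd_vertices_symdiff (odd_vertices_symdiff J J1).
  rewrite (minimum_joinP mF) bJ bJ1.
  by apply/eqP/setP=> z; rewrite !in_symdiff addbb addbF.
rewrite symdiff_setI in c2.
have c3 := card_symdiff F (J :\: inner_edges R).
have c4 := card_symdiff F J.
have JE : F :+: J = J' by rewrite /J symdiffA symdiffxx symdiffC symdiff0.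
have c5 := cardsID (inner_edges R) J.
have c6 := cardsID (inner_edges R) (F :&: J).
rewrite -setIA -/J1 -setIDA in c6.
rewrite -/J1 in c5.
rewrite -JE; clear -w1 c2 c3 c4 c5 c6; lia.
Qed.

Lemma simE x y : sim T x y = fc x y && (nu T <= nu (T :+: [set x] :+: [set y])).
Proof.
have [<-|xy] := eqVneq x y.
  by rewrite symdiffK leqnn andbT /sim /= eqxx; apply/esym/connect0.
rewrite /sim /= (negPf xy) /= symdiff_set2 // symdiffA.
have -> : [exists C, [&& factor_component T C, x \in C & y \in C]] = fc x y.
  apply/existsP/factor_componentP => -[C]; first by move/and3P; exists C.
  by move=> H; exists C; apply/and3P.
case f: (fc x y) => //=.
by rewrite eqn_leq (factor_connected_nu f) andbT.
Qed.

Lemma sim_top r u x y : reach (T :+: [set r]) u ->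
  x \in level_comp (T :+: [set r]) u -> y \in level_comp (T :+: [set r]) u ->
  root_level (T :+: [set r]) x = root_level (T :+: [set r]) u ->
  root_level (T :+: [set r]) y = root_level (T :+: [set r]) u ->
  fc x y -> sim T x y.
Proof. by move=> ru xu yu lx ly xy; rewrite simE xy (top_level_nu ru xu yu lx ly). Qed.

Lemma sim_refl : reflexive (sim T).
Proof. by move=> x; rewrite /sim /= eqxx. Qed.

Lemma sim_sym : symmetric (sim T).
Proof.
move=> x y; rewrite !simE factor_connected_sym.
by rewrite -symdiffA [[set x] :+: _]symdiffC symdiffA.
Qed.

Lemma sim_nu x y : sim T x y -> nu (T :+: [set x] :+: [set y]) = nu T.
Proof. by rewrite simE => /andP[xy le]; apply/eqP; rewrite eqn_leq le factor_connected_nu. Qed.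

(* Rooted at the middle vertex, both ends lie on the top level of the component
   of the root. *)
Lemma sim_trans : transitive (sim T).
Proof.
move=> y x z xy yz; have yx : sim T y x by rewrite sim_sym.
have fyx : fc y x by move: yx; rewrite simE => /andP[].
have fyz : fc y z by move: yz; rewrite simE => /andP[].
have top w : sim T y w -> root_level (T :+: [set y]) w = root_level (T :+: [set y]) y.
  by move=> /sim_nu E; rewrite /root_level E symdiffK.
have fxz : fc x z by apply: factor_connected_trans fyz; rewrite factor_connected_sym.
exact: (sim_top (reach_root mF y) (factor_connected_level_comp fyx)
  (factor_connected_level_comp fyz) (top _ yx) (top _ yz) fxz).
Qed.

Lemma sim_classP S : reflect (exists x, S = [set y | sim T x y]) (S \in sim_classes T).
Proof.
apply: (iffP imsetP) => [[x _ ->]|[x ->]]; exists x => //.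
all: by apply/setP=> y; rewrite !inE.
Qed.

Lemma sim_class_mem S x : S \in sim_classes T -> x \in S -> S = [set y | sim T x y].
Proof.
case/sim_classP=> z ->; rewrite inE => zx; apply/setP=> y; rewrite !inE.
apply/idP/idP; last exact: sim_trans.
by apply: sim_trans; rewrite sim_sym.
Qed.

End Classes.

(** * Decapital components *)

Section Decapital.
Variables (G : graph) (bipG : bipartite G) (T : {set vertex G}) (F : {set edge G}).
Hypothesis mF : minimum_join T F.
Variable r : vertex G.
Local Notation U := (T :+: [set r]).
Local Notation reach := (reach U).
Local Notation level := (root_level U).
Local Notation level_comp := (level_comp U).
Local Notation fc := (factor_connected T).
Implicit Types (x y z u v w : vertex G) (e : edge G) (S C : {set vertex G}).

(** Without [e] nothing crosses the boundary; [e] accounts for its inner end [x]. *)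
Lemma odd_vertices_inner1 (X : {set vertex G}) (J : {set edge G}) e x y :
  J :&: boundary X = [set e] -> ends e = [set x; y] -> x \in X -> y \notin X ->
  odd_vertices (J :&: inner_edges X) = (odd_vertices J :&: X) :+: [set x].
Proof.
move=> J1 E xX yX.
have eJ : e \in J by have := set11 e; rewrite -J1 in_setI => /andP[].
have eX : e \in boundary X by apply/boundaryP; exists x, y.
have -> : J :&: inner_edges X = (J :+: [set e]) :&: inner_edges X.
  apply/setP=> f; rewrite !in_setI in_symdiff in_set1; case: eqP => [->|_]; rewrite ?addbF //.
  by case: (boolP (e \in inner_edges X)) => [/inner_not_boundary|]; rewrite ?andbF // eX.
rewrite odd_vertices_inner; last first.
  by rewrite symdiffIl J1 (setIidPl _) ?sub1set // symdiffxx.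
rewrite odd_vertices_symdiff odd_vertices1 E symdiffIl symdiff_set2 ?(ends_neq E) //.
rewrite [X in _ :+: X]symdiffIl [[set x] :&: _](setIidPl _) ?sub1set //.
suff -> : [set y] :&: X = set0 by rewrite symdiff0.
by apply/setP=> f; rewrite in_setI in_set1 in_set0; case: eqP => // ->; apply/negbTE.
Qed.

Lemma boundary_set1 u e F' : reach u -> r \notin level_comp u -> minimum_join T F' ->
  e \in F' -> e \in boundary (level_comp u) -> F' :&: boundary (level_comp u) = [set e].
Proof.
move=> ru rK mF' eF' eK.
have /eqP := card_join_boundary bipG ru (minj_root r mF'); rewrite rK => /cards1P[f E].
have : e \in F' :&: boundary (level_comp u) by rewrite in_setI eF'.
by rewrite E in_set1 => /eqP->.
Qed.

Lemma allowed_boundary u : reach u -> r \notin level_comp u ->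
  exists e a b, [/\ allowed T e, ends e = [set a; b], a \in level_comp u & b \notin level_comp u].
Proof.
move=> ru rK; have /eqP := card_join_boundary bipG ru (minj_root r mF).
rewrite rK => /cards1P[e /setP/(_ e)]; rewrite in_setI in_set1 eqxx => /andP[eF].
case/boundaryP=> a [b [E aK bK]]; exists e, a, b; split=> //.
by apply/allowedP; exists F.
Qed.

(** Take minimum joins through [e] and [e']. Each crosses the boundary only there, so the inner part
    of their difference has odd vertices [x] and [x'], and all its edges are allowed. *)
Lemma inner_ends_factor_connected u e e' x y x' y' : reach u -> r \notin level_comp u ->
  allowed T e -> ends e = [set x; y] -> x \in level_comp u -> y \notin level_comp u ->
  allowed T e' -> ends e' = [set x'; y'] -> x' \in level_comp u -> y' \notin level_comp u ->
  fc x x'.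
Proof.
move=> ru rK /allowedP[F1 m1 e1] E xK yK /allowedP[F2 m2 e2] E' xK' yK'.
have [<-|xx'] := eqVneq x x'; first exact: connect0.
set K := level_comp u.
have eK : e \in boundary K by apply/boundaryP; exists x, y.
have eK' : e' \in boundary K by apply/boundaryP; exists x', y'.
have bJ : odd_vertices ((F1 :+: F2) :&: inner_edges K) = [set x; x'].
  rewrite symdiffIl odd_vertices_symdiff.
  rewrite (odd_vertices_inner1 (boundary_set1 ru rK m1 e1 eK) E) //.
  rewrite (odd_vertices_inner1 (boundary_set1 ru rK m2 e2 eK') E') //.
  rewrite (minimum_joinP m1) (minimum_joinP m2) symdiff_set2 //.
  by apply/setP=> z; rewrite !in_symdiff; do 3!case: (z \in _).
apply: connect_sub (odd_vertices_connect bJ) => a b /existsP[f /andP[]].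
rewrite in_setI => /andP[fD _] /eqP Ef; apply: connect1; apply: allowed_adj_intro Ef.
apply/allowedP; move: fD; rewrite in_symdiff; case f1: (f \in F1); first by exists F1.
by exists F2.
Qed.

(** In other words, [x] and [z] are at negative distance. Let [D] be the inner difference between a
    minimum join [F1] of [T] through [e] and one rooted at [z]; it leads from [z] to the top vertex
    [z']. Switching cannot shrink the latter join, as [z'] is at least as high as [z], so it does
    not enlarge [F1]; deleting [e] then saves an edge. *)
Lemma nu_outer_end_lt u e x z z' : reach u -> r \notin level_comp u -> allowed T e ->
  ends e = [set z'; x] -> z' \in level_comp u -> x \notin level_comp u ->
  z \in level_comp u -> nu (T :+: [set x] :+: [set z]) < nu T.
Proof.
move=> ru rK /allowedP[F1 m1 e1] E zK' xK zK; set K := level_comp u.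
have eK : e \in boundary K by apply/boundaryP; exists z', x.
have [rz le_z] := level_compP ru zK.
have [Fz [mz bz nz]] := reach_level rz.
have Fz0 : Fz :&: boundary K = set0.
  by apply/eqP; rewrite -cards_eq0 (card_join_boundary bipG ru mz) zK.
have bD : odd_vertices ((F1 :+: Fz) :&: inner_edges K) = [set z] :+: [set z'].
  rewrite symdiffIl odd_vertices_symdiff (odd_vertices_inner Fz0).
  rewrite (odd_vertices_inner1 (boundary_set1 ru rK m1 e1 eK) E) //.
  rewrite (minimum_joinP m1) bz !symdiffIl [[set z] :&: _](setIidPl _) ?sub1set //.
  have -> : [set r] :&: K = set0.
    by apply/setP=> t; rewrite in_setI in_set1 in_set0; case: eqP => // ->; apply/negbTE.
  by apply/setP=> t; rewrite symdiff0 !in_symdiff; do 3!case: (t \in _).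
set D := _ :&: _ in bD.
have sD : D \subset F1 :+: Fz by apply: subsetIl.
have bal := card_symdiff_balance sD.
have le1 := level_le_card (join_shift bz bD).
have [_ le2] := level_compP ru zK.
have [_ lz' _] := level_comp_boundary bipG ru E zK' xK.
have bF1 : odd_vertices (F1 :+: D :+: [set e]) = T :+: [set x] :+: [set z].
  rewrite !odd_vertices_symdiff bD odd_vertices1 E (minimum_joinP m1).
  rewrite symdiff_set2 ?(ends_neq E) //.
  by apply/setP=> t; rewrite !in_symdiff; do 4!case: (t \in _).
have e1D : e \in F1 :+: D.
  rewrite in_symdiff e1 in_setI; case: (boolP (e \in inner_edges K)) => [/inner_not_boundary|_].
    by rewrite eK.
  by rewrite andbF.
rewrite -bF1; apply: leq_ltn_trans (nu_le_odd _) _; rewrite card_symdiff1 //.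
have pos : 0 < #|F1 :+: D| by apply/card_gt0P; exists e.
have n1 := minimum_join_nu m1.
clear -bal le1 le2 lz' pos n1 nz le_z; lia.
Qed.

(** * A fixed decapital component and its classes *)

Section Component.
Variables (u : vertex G).
Hypotheses (ru : reach u) (rK : r \notin level_comp u).
Local Notation K := (level_comp u).
Local Notation A := (Aset F r K).
Local Notation D := (Dset F r K).

Lemma sim_Aset x y : x \in A -> y \in A -> fc x y -> sim T x y.
Proof.
rewrite !(Aset_level_comp mF) // => /andP[xK /eqP lx] /andP[yK /eqP ly].
exact: (sim_top bipG mF ru xK yK lx ly).
Qed.

Lemma Dset_component_sub C : C \in components D -> C \subset D.
Proof. by case/imsetP=> x _ ->; apply/subsetP=> y; rewrite in_set => /andP[]. Qed.

(** From below the top, one edge climbs at most to the top level, so [b] is still in [K]; in D(K) it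
    would belong to [C]. *)
Lemma Dset_component_exit C e a b : C \in components D -> ends e = [set a; b] ->
  a \in C -> b \notin C -> b \in A.
Proof.
move=> Cc E aC bC; have aD := subsetP (Dset_component_sub Cc) _ aC.
have /andP[aK la] : (a \in K) && (level a < level u) by rewrite -(Dset_level_comp mF).
have [ra _] := level_compP ru aK.
have lb : level b <= level u := leq_trans (level_edge_le E ra) la.
have bK := level_comp_edge ru E aK lb.
apply: contraNT bC => bA; have bD : b \in D by rewrite in_setD bA.
case/imsetP: Cc aC => x xD ->; rewrite in_set => /andP[_ xa].
rewrite in_set bD; apply: connect_trans xa (connect1 _).
exact: (induced_adj_intro E).
Qed.

Lemma Dset_component_decapital C : C \in components D ->
  exists w, [/\ reach w, r \notin level_comp w & C = level_comp w].
Proof.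
move=> Cc; have [w [_ rw CE]] := Dset_component mF ru Cc.
exists w; split=> //; rewrite -CE; apply: contra rK => rC.
by have := subsetP (Dset_component_sub Cc) _ rC; rewrite in_setD => /andP[].
Qed.

(** Otherwise [z] lies in a component of G[D(K)], and an allowed path from [z] to [x] leaves it at
    some [b] in A(K). Then [b] ~ [x] ~ [z], which contradicts the strict inequality of
    [nu_outer_end_lt]. *)
Lemma sim_Aset_closed x z : x \in A -> z \in K -> sim T x z -> z \in A.
Proof.
move=> xA zK xz; apply/negPn/negP=> zA; have zD : z \in D by rewrite in_setD zA.
set C := [set y in D | connect (induced_adj D) z y].
have Cc : C \in components D by apply: imset_f.
have zC : z \in C by rewrite in_set zD connect0.
have xC : x \notin C by rewrite in_set in_setD xA.
have fzx : fc z x by move: xz; rewrite (simE bipG mF) factor_connected_sym => /andP[].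
have [e [a [b [ae E aC bC [_ fbx]]]]] := factor_connected_exit fzx zC xC.
have bA := Dset_component_exit Cc E aC bC.
have bz : sim T b z by apply: (sim_trans bipG mF) xz; apply: sim_Aset.
have [w [rw rC CE]] := Dset_component_decapital Cc; rewrite CE in zC aC bC.
have := nu_outer_end_lt rw rC ae E aC bC zC.
by rewrite (sim_nu bipG mF bz) ltnn.
Qed.

Lemma inner_endsP s : s \in inner_ends T K ->
  exists e t, [/\ allowed T e, ends e = [set s; t], s \in K & t \notin K].
Proof.
rewrite inE => /andP[sK /existsP[e /and3P[/boundaryP[a [b [E aK bK]]] ae se]]].
exists e, b; split=> //; move: se; rewrite E in_set2 => /orP[]/eqP sE; first by rewrite sE.
by move: bK; rewrite -sE sK.
Qed.

Lemma inner_ends_intro e a b : allowed T e -> ends e = [set a; b] -> a \in K ->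
  b \notin K -> a \in inner_ends T K.
Proof.
move=> ae E aK bK; rewrite inE aK; apply/existsP; exists e.
by rewrite ae E set21 andbT andbT; apply/boundaryP; exists a, b.
Qed.

Lemma inner_ends_Aset s : s \in inner_ends T K -> s \in A.
Proof.
move=> /inner_endsP[e [t [_ E sK tK]]]; rewrite (Aset_level_comp mF) // sK.
by have [_ -> _] := level_comp_boundary bipG ru E sK tK; rewrite eqxx.
Qed.

Lemma inner_ends_sim s s' : s \in inner_ends T K -> s' \in inner_ends T K -> sim T s s'.
Proof.
move=> sI sI'; apply: sim_Aset; try exact: inner_ends_Aset.
have [e [t [ae E sK tK]]] := inner_endsP sI; have [e' [t' [ae' E' sK' tK']]] := inner_endsP sI'.
exact: inner_ends_factor_connected ru rK ae E sK tK ae' E' sK' tK'.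
Qed.

Lemma inner_ends_nonempty : exists s, s \in inner_ends T K.
Proof.
have [e [a [b [ae E aK bK]]]] := allowed_boundary ru rK.
by exists a; apply: inner_ends_intro E _ _.
Qed.

Lemma root_classE s : s \in inner_ends T K -> root_class T K = [set y | sim T s y].
Proof.
move=> sI; rewrite /root_class; case: pickP => [S /andP[Sc sub]|/(_ [set y | sim T s y])] /=.
  by apply: (sim_class_mem bipG mF Sc); rewrite (subsetP sub).
case/negP; apply/andP; split; first by apply/sim_classP; exists s.
by apply/subsetP=> s' sI'; rewrite inE; apply: inner_ends_sim.
Qed.

(** An allowed path leaving [K] passes through an inner end. That vertex is in A(K) and
    factor-connected to [x], hence equivalent to it. *)
Lemma factor_connected_leave x z : x \in A -> fc x z -> z \notin K -> x \in root_class T K.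
Proof.
move=> xA xz zK; have xK : x \in K by move: xA; rewrite inE => /andP[].
have [e [a [b [ae E aK bK [xa _]]]]] := factor_connected_exit xz xK zK.
have aI := inner_ends_intro ae E aK bK.
rewrite (root_classE aI) inE (sim_sym bipG mF).
by apply: sim_Aset => //; apply: inner_ends_Aset.
Qed.

Lemma Aset_sub x : x \in A -> x \in K.
Proof. by rewrite inE => /andP[]. Qed.

(** By [sim_Aset_closed], a class meeting A(K) has the same trace on [K] as on A(K). Unless it is
    the root class, it lies entirely in [K] by [factor_connected_leave], so it needs no cutting
    down. *)
Lemma AfamilyE : Afamily T F r K = equivalence_partition (sim T) A.
Proof.
have [s sI] := inner_ends_nonempty; have sA := inner_ends_Aset sI.
have RC := root_classE sI.
have simK x : x \in A -> [set y in A | sim T x y] = [set y | sim T x y] :&: K.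
  move=> xA; apply/setP=> y; rewrite in_setI [LHS]in_set [y \in [set _ | _]]in_set andbC.
  case xy: (sim T x y) => //=; apply/idP/idP => [/Aset_sub //|yK].
  exact: sim_Aset_closed xA yK xy.
apply/setP=> S; rewrite in_setU1; apply/orP/imsetP.
  case=> [/eqP->|]; first by exists s => //; rewrite simK // /root_fragment RC.
  rewrite inE in_setD1 => /andP[/andP[SR Sc] /set0Pn[x]]; rewrite in_setI => /andP[xS xA].
  have SE := sim_class_mem bipG mF Sc xS; exists x => //.
  rewrite simK // -SE (setIidPl _) //; apply/subsetP=> y; rewrite SE inE => xy.
  have fxy : fc x y by move: xy; rewrite (simE bipG mF) => /andP[].
  apply: contraNT SR => yK; have := factor_connected_leave xA fxy yK.
  rewrite RC SE => sx; apply/eqP/esym/(sim_class_mem bipG mF) => //.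
  by apply/sim_classP; exists s.
case=> x xA ->; rewrite simK //.
case xR: (x \in root_class T K).
  left; rewrite /root_fragment; apply/eqP; congr (_ :&: _); apply/esym.
  by apply: (sim_class_mem bipG mF) xR; rewrite RC; apply/sim_classP; exists s.
right; have xx : x \in [set y | sim T x y] by rewrite inE sim_refl.
have -> : [set y | sim T x y] :&: K = [set y | sim T x y].
  apply/setIidPl/subsetP=> y; rewrite inE => xy; apply/negPn/negP=> yK.
  have fxy : fc x y by move: xy; rewrite (simE bipG mF) => /andP[].
  by move: (factor_connected_leave xA fxy yK); rewrite xR.
rewrite inE in_setD1; apply/andP; split; last first.
  by apply/set0Pn; exists x; rewrite in_setI xx.
apply/andP; split; last by apply/sim_classP; exists x.
by apply/eqP=> E; move: xx; rewrite E xR.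
Qed.

Lemma Afamily_sim S x y : S \in Afamily T F r K -> x \in S -> y \in S -> x \in A /\ sim T x y.
Proof.
rewrite AfamilyE => /imsetP[z _ ->]; rewrite in_set => /andP[xA zx].
rewrite in_set => /andP[_ zy].
split=> //; apply: (sim_trans bipG mF) zy; by rewrite (sim_sym bipG mF).
Qed.

Lemma sim_equivalence : {in A & &, equivalence_rel (sim T)}.
Proof.
move=> x y z _ _ _; split; first exact: sim_refl.
move=> xy; apply/idP/idP; last exact: (sim_trans bipG mF).
by apply: (sim_trans bipG mF); rewrite (sim_sym bipG mF).
Qed.

Lemma Afamily_partition : partition (Afamily T F r K) A.
Proof. by rewrite AfamilyE; apply: equivalence_partitionP; apply: sim_equivalence. Qed.

(** If [C] left [K], a vertex of [S] in A(K) would belong to the root class, and [S] would be that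
    class. *)
Lemma factor_component_sub S C : S \in Afamily T F r K :\ root_fragment T K ->
  factor_component T C -> S \subset C -> C \subset K.
Proof.
rewrite in_setD1 in_setU1 => /andP[/negPf-> /=].
rewrite inE in_setD1 => /andP[/andP[SR Sc] /set0Pn[x]]; rewrite in_setI => /andP[xS xA].
move=> Cf /subsetP SC; apply/subsetP=> z zC; apply: contraNT SR => zK.
have xR := factor_connected_leave xA (factor_componentE Cf (SC x xS) zC) zK.
have [s sI] := inner_ends_nonempty.
rewrite (sim_class_mem bipG mF Sc xS); apply/eqP/esym/(sim_class_mem bipG mF) => //.
by rewrite (root_classE sI); apply/sim_classP; exists s.
Qed.

(** A component of G[D(K)] is itself a decapital level component, so an allowed edge leaves it; the
    class of its outer end, which is in A(K), is the index sought. *)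
Lemma components_Nfamily :
  components D = \bigcup_(S in Afamily T F r K) Nfamily T F r K S.
Proof.
apply/setP=> C; apply/idP/bigcupP => [Cc|[S _]]; last by rewrite inE => /andP[].
have [w [rw rC CE]] := Dset_component_decapital Cc.
have [e [a [b [ae E aC bC]]]] := allowed_boundary rw rC; rewrite -CE in aC bC.
have bA := Dset_component_exit Cc E aC bC.
exists [set y in A | sim T b y]; first by rewrite AfamilyE; apply: imset_f.
rewrite inE Cc; apply/existsP; exists a; rewrite aC; apply/existsP; exists b.
by rewrite in_set bA sim_refl; apply: allowed_adj_intro ae E.
Qed.

(** Allowed edges leaving the same component have factor-connected inner ends, hence
    factor-connected outer ends. These lie in A(K), where factor-connected vertices are
    equivalent. *)
Lemma Nfamily_disjoint S S' : S \in Afamily T F r K -> S' \in Afamily T F r K -> S != S' ->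
  [disjoint Nfamily T F r K S & Nfamily T F r K S'].
Proof.
move=> SA SA'; apply: contraNT; rewrite -setI_eq0 => /set0Pn[C].
rewrite in_setI ![C \in Nfamily _ _ _ _ _]inE => /andP[/andP[Cc H] /andP[_ H']].
have [w [rw rC CE]] := Dset_component_decapital Cc.
have outC t V : V \in Afamily T F r K -> t \in V -> t \in A /\ t \notin level_comp w.
  move=> VA tV; have [tA _] := Afamily_sim VA tV tV; split=> //.
  rewrite -CE; apply: contraL tA => /(subsetP (Dset_component_sub Cc)).
  by rewrite in_setD => /andP[].
case/existsP: H => a /andP[aC /existsP[b /andP[bS ab]]].
case/existsP: H' => a' /andP[aC' /existsP[b' /andP[bS' ab']]].
have [bA bC] := outC _ _ SA bS; have [bA' bC'] := outC _ _ SA' bS'.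
have [e ae E] := allowed_adjP _ _ _ ab; have [e' ae' E'] := allowed_adjP _ _ _ ab'.
rewrite CE in aC aC'.
have faa := inner_ends_factor_connected rw rC ae E aC bC ae' E' aC' bC'.
have fbb : fc b b'.
  apply: connect_trans (connect1 _) (connect_trans faa (connect1 ab')).
  by rewrite allowed_adj_sym.
have bb := sim_Aset bA bA' fbb.
have Pt := Afamily_partition; have tI : trivIset (Afamily T F r K) by case/and3P: Pt.
have b'S : b' \in S.
  move: SA bS; rewrite AfamilyE => /imsetP[z _ ->]; rewrite in_set => /andP[_ zb].
  by rewrite in_set bA' (sim_trans bipG mF zb bb).
by rewrite -(def_pblock tI SA b'S) -(def_pblock tI SA' bS').
Qed.

End Component.
End Decapital.

Theorem theorem8p3 (G : graph) (T : {set vertex G}) (hG : bipartite G)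
    (hT : graft T) (F : {set edge G}) (hF : minimum_join T F) (r : vertex G)
    (K : {set vertex G}) (hK : decapital F r K) :
  [/\ partition (Afamily T F r K) (Aset F r K),
      forall S C : {set vertex G},
        S \in Afamily T F r K :\ root_fragment T K ->
        factor_component T C -> S \subset C -> C \subset K
    & components (Dset F r K) = \bigcup_(S in Afamily T F r K) Nfamily T F r K S
      /\ forall S S' : {set vertex G},
        S \in Afamily T F r K -> S' \in Afamily T F r K -> S != S' ->
        [disjoint Nfamily T F r K S & Nfamily T F r K S']].
Proof.
case: hK => /(distance_component_level_comp hF)[u ru ->] rK; split.
- exact: Afamily_partition.
- by move=> S C; apply: factor_component_sub.
- split; first exact: components_Nfamily.
  by move=> S S'; apply: Nfamily_disjoint.
Qed.
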